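(* Assume $n r_n^d\to 0$ as $n\to\infty$ and let $1\le k\le d$. Then \[ \lim_{n\to\infty}\big(n^{k+1}r_n^{dk}\big)^{-1}\mathbb{E}\{N_{k,n}\}=\mu_k \quad\text{and}\quad \lim_{n\to\infty}\big(n^{k+1}r_n^{dk}\big)^{-1}\mathbb{E}\{\widehat N_{k,n}\}=\mu_k, \] where \[ \mu_k=\frac{1}{(k+1)!}\int_{\mathbb{R}^d}f^{k+1}(x)\,dx\int_{(\mathbb{R}^d)^k}h_1(0,\mathbf{y})\,d\mathbf{y}. \]
   Context: Fix $d\ge1$. Let $f$ be a bounded probability density on $\mathbb{R}^d$. For each $n$, $\mathcal{X}_n=\{X_1,\dots,X_n\}$ where $X_1,X_2,\dots$ are i.i.d. with density $f$, and $\mathcal{P}_n$ is a Poisson point process on $\mathbb{R}^d$ with intensity function $nf$. $(r_n)_{n\ge1}$ is a sequence of positive numbers with $r_n\to0$. For a finite set $\mathcal{P}\subset\mathbb{R}^d$ let $d_{\mathcal{P}}(x)=\min_{p\in\mathcal{P}}\|x-p\|$. For a set $\mathcal{Y}$ of $k+1$ affinely independent points of $\mathbb{R}^d$, $C(\mathcal{Y})$ is the center and $R(\mathcal{Y})$ the radius of the unique $(k-1)$-dimensional sphere containing $\mathcal{Y}$ (so $C(\mathcal{Y})$ is the point of the affine hull of $\mathcal{Y}$ equidistant from all points of $\mathcal{Y}$), and $\mathrm{conv}^\circ(\mathcal{Y})$ is the interior of the convex hull of $\mathcal{Y}$ (an open $k$-simplex). For $1\le k\le d$, a point $c\in\mathbb{R}^d$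 is a critical point of index $k$ of $d_{\mathcal{P}}$ if there is a subset $\mathcal{Y}\subset\mathcal{P}$ of $k+1$ affinely independent points with $\|c-y\|=d_{\mathcal{P}}(c)$ for all $y\in\mathcal{Y}$, $\|c-p\|>d_{\mathcal{P}}(c)$ for all $p\in\mathcal{P}\setminus\mathcal{Y}$, and $c\in\mathrm{conv}^\circ(\mathcal{Y})$. $N_{k,n}$ is the number of critical points $c$ of index $k$ of $d_{\mathcal{X}_n}$ with $d_{\mathcal{X}_n}(c)\le r_n$, and $\widehat N_{k,n}$ is the number of critical points $c$ of index $k$ of $d_{\mathcal{P}_n}$ with $d_{\mathcal{P}_n}(c)\le r_n$. For $\mathbf{y}=(y_1,\dots,y_k)\in(\mathbb{R}^d)^k$, $h_1(0,\mathbf{y})=1$ if $\{0,y_1,\dots,y_k\}$ consists of $k+1$ affinely independent points $\mathcal{Y}$ with $C(\mathcal{Y})\in\mathrm{conv}^\circ(\mathcal{Y})$ and $R(\mathcal{Y})\le 1$, and $h_1(0,\mathbf{y})=0$ otherwise. *)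

(* Defs.v *)
From HB Require Import structures.
From mathcomp Require Import all_boot all_order all_algebra.
From mathcomp Require Import all_classical all_reals all_analysis.
Set Implicit Arguments. Unset Strict Implicit. Unset Printing Implicit Defensive.
Import Order.TTheory GRing.Theory Num.Theory.
Local Open Scope classical_set_scope.
Local Open Scope ring_scope.

(* alias of 'M[R]_(m,n) with a pointed structure (needed for sigma-algebras) *)
Definition mxpt (R : realType) (m n : nat) := 'M[R]_(m, n).
HB.instance Definition _ (R : realType) m n := Choice.on (mxpt R m n).
HB.instance Definition _ (R : realType) m n :=
  isPointed.Build (mxpt R m n) (0%R : 'M[R]_(m, n)).

Definition mxbox (R : realType) (m n : nat) (a b : 'M[R]_(m, n)) : set (mxpt R m n) :=
  [set A | forall i j, a i j <= A i j <= b i j].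

Definition mxboxes (R : realType) (m n : nat) : set (set (mxpt R m n)) :=
  [set B | exists a b, B = mxbox a b].

(* 'M[R]_(m,n) ~ R^(m*n) equipped with the sigma-algebra generated by closed
   boxes, i.e. the Borel sigma-algebra. R^d is mxspace R 1 d (row vectors),
   (R^d)^k is mxspace R k d (row i = i-th point). *)
Definition mxspace (R : realType) (m n : nat) := g_sigma_algebraType (@mxboxes R m n).

(* lam is Lebesgue measure: it gives every closed box its volume.  This
   determines lam uniquely on the Borel sets (pi-lambda theorem). *)
Definition is_lebesgue (R : realType) (m n : nat)
  (lam : {measure set (mxspace R m n) -> \bar R}) : Prop :=
  forall a b : 'M[R]_(m, n), (forall i j, a i j <= b i j) ->
    lam (mxbox a b) = (\prod_(i < m) \prod_(j < n) (b i j - a i j))%:E.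

Section Geometry.
Variable R : realType.

Definition enorm (d : nat) (v : 'rV[R]_d) : R := Num.sqrt (\sum_(i < d) v 0 i ^+ 2).

Definition distfun (d : nat) (S : set 'rV[R]_d) (x : 'rV[R]_d) : R :=
  inf [set enorm (x - p) | p in S].

Definition affinely_independent (d k : nat) (y : 'I_k.+1 -> 'rV[R]_d) : Prop :=
  row_free (\matrix_(i < k) (y (lift ord0 i) - y ord0)).

Definition aff_hull (d k : nat) (y : 'I_k.+1 -> 'rV[R]_d) : set 'rV[R]_d :=
  [set x | exists l : 'I_k.+1 -> R, \sum_i l i = 1 /\ x = \sum_i l i *: y i].

Definition open_simplex (d k : nat) (y : 'I_k.+1 -> 'rV[R]_d) : set 'rV[R]_d :=
  [set x | exists l : 'I_k.+1 -> R,
     (forall i, 0 < l i) /\ \sum_i l i = 1 /\ x = \sum_i l i *: y i].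

Definition circumcenter (d k : nat) (y : 'I_k.+1 -> 'rV[R]_d) : 'rV[R]_d :=
  xget 0 [set c | aff_hull y c /\ forall i, enorm (c - y i) = enorm (c - y ord0)].

Definition circumradius (d k : nat) (y : 'I_k.+1 -> 'rV[R]_d) : R :=
  enorm (circumcenter y - y ord0).

Definition is_critical (d : nat) (S : set 'rV[R]_d) (k : nat) (c : 'rV[R]_d) : Prop :=
  exists y : 'I_k.+1 -> 'rV[R]_d,
    [/\ forall i, S (y i),
        affinely_independent y,
        forall i, enorm (c - y i) = distfun S c,
        forall p, S p -> ~ (exists i, p = y i) -> distfun S c < enorm (c - p)
      & open_simplex y c].

Definition Ncrit (d : nat) (S : set 'rV[R]_d) (k : nat) (r : R) : \bar R :=
  counting [set c | is_critical S k c /\ distfun S c <= r].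

(* the points {0, y_1, ..., y_k} for Y in (R^d)^k (row i of Y = y_(i+1)) *)
Definition pts0 (d k : nat) (Y : 'M[R]_(k, d)) : 'I_k.+1 -> 'rV[R]_d :=
  fun i => match unlift ord0 i with None => 0 | Some j => row j Y end.

Definition h1 (d k : nat) (Y : 'M[R]_(k, d)) : R :=
  if `[< [/\ affinely_independent (pts0 Y),
            open_simplex (pts0 Y) (circumcenter (pts0 Y))
          & circumradius (pts0 Y) <= 1] >] then 1 else 0.

End Geometry.

Definition mutually_independent (R : realType) (dO : measure_display)
  (Omega : measurableType dO) (P : probability Omega R) (d : nat)
  (X : nat -> Omega -> mxspace R 1 d) : Prop :=
  forall (s : seq nat) (A : nat -> set (mxspace R 1 d)), uniq s ->
    (forall i, measurable (A i)) ->
    P (\bigcap_(i in [set` s]) (X i @^-1` A i)) =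
      (\big[*%E/1%E]_(i <- s) P (X i @^-1` A i))%E.

Definition poisson_pmf' (R : realType) (m : R) (j : nat) : R :=
  m ^+ j / j`!%:R * expR (- m).

Definition count_in (R : realType) (d : nat) (A : set 'rV[R]_d) (s : seq 'rV[R]_d) : nat :=
  count (fun x => `[< A x >]) s.

Definition is_poisson_process (R : realType) (dO : measure_display)
  (Omega : measurableType dO) (P : probability Omega R) (d : nat)
  (lam : {measure set (mxspace R 1 d) -> \bar R}) (g : mxspace R 1 d -> R)
  (PP : Omega -> seq 'rV[R]_d) : Prop :=
  (forall (A : set (mxspace R 1 d)) (j : nat), measurable A ->
      measurable [set w | count_in A (PP w) = j]) /\
  (forall (m : nat) (A : 'I_m -> set (mxspace R 1 d)) (j : 'I_m -> nat),
      (forall l, measurable (A l)) ->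
      (forall l l', l != l' -> A l `&` A l' = set0) ->
      P (\bigcap_l [set w | count_in (A l) (PP w) = j l]) =
        (\prod_(l < m) poisson_pmf' (fine (\int[lam]_(x in A l) (g x)%:E)%E) (j l))%:E).

(* Main.v *)
Require Import Defs.
From HB Require Import structures.
From mathcomp Require Import all_boot all_order all_algebra fingroup perm.
From mathcomp Require Import all_classical all_reals all_analysis.
From mathcomp Require Import measurable_realfun.
From mathcomp Require Import ring lra zify.
Set Implicit Arguments.
Unset Strict Implicit.
Unset Printing Implicit Defensive.
Import Order.TTheory GRing.Theory Num.Theory.
Import numFieldNormedType.Exports.
Local Open Scope classical_set_scope.
Local Open Scope ring_scope.

(* Write [H_r] for the set of (k+1)-tuples of points in general position whose
   circumcenter lies in their open simplex at distance at most r. A critical point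
   of index k and height at most r determines, up to order, a tuple of [H_r], and
   conversely a tuple of [H_r] whose closed circumball contains no further point of
   the sample produces a critical point; tuples with an intruder extend to
   (k+2)-tuples in a set [V_r]. Counting tuples of distinct indices,
     T_{k+1}(H_r) - T_{k+2}(V_r) <= (k+1)! N <= T_{k+1}(H_r).
   The expectation of [T_m(B)] is the integral of prod f(y_i) over B, times
   n(n-1)...(n-m+1) for the i.i.d. sample and times n^m for the Poisson process.
   Since [V_r] forces the intruder into a cube of side 4r, its contribution is
   O(n r^d) relative to the main term. The substitution y_i = x + r z_i turns the
   main term into r^{dk} times the integral, over the z satisfying [h_1], of
   f(x) prod f(x + r z_i) dx, which tends to the integral of f^{k+1} because
   translations are continuous in L^1. *)

(** * Measurability on matrix spaces *)

(** The two samples differ only in their factorial moments, so the limit is proved once for a random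
    list [pts n w] with moment factors [c1 n] and [c2 n]. For fixed m, E T_m(B) is a measure in B,
    because T_m is a finite sum of Dirac masses; it is therefore determined by its values on boxes,
    which are products of row-wise boxes. For the i.i.d. sample independence gives these values at
    once. For the Poisson process only the joint law of counts on disjoint sets is available, while
    the sides A_i may overlap: they are cut into atoms, on which T_m becomes a sum of products of
    falling factorials of independent Poisson counts. The tuples consist of indices, not of points.
    This keeps the moment formulas exact when the list has repetitions; a repeated vertex acts as
    one more intruder. The geometric conditions are made measurable through the Gram matrix of the
    edge vectors, which is invertible exactly when the points are affinely independent, also for k <
    d. *)

Section MatrixSpace.
Variable R : realType.

Lemma measurable_mxbox m n (a b : 'M[R]_(m, n)) :
  measurable (mxbox a b : set (mxspace R m n)).
Proof. by apply: sub_sigma_algebra; exists a, b. Qed.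

Lemma mxspace_measurableE m n :
  @measurable _ (mxspace R m n) = <<s @mxboxes R m n >>.
Proof. by []. Qed.

Lemma setI_closed_mxboxes m n : setI_closed (@mxboxes R m n).
Proof.
move=> _ _ [a [b ->]] [a' [b' ->]].
exists (\matrix_(i, j) Num.max (a i j) (a' i j)),
       (\matrix_(i, j) Num.min (b i j) (b' i j)).
apply/seteqP; split => Y /=.
  move=> [h h'] i j; rewrite !mxE ge_max le_min.
  by have /andP[-> ->] := h i j; have /andP[-> ->] := h' i j.
move=> h; split => i j; have := h i j; rewrite !mxE ge_max le_min.
  by move=> /andP[/andP[-> _] /andP[-> _]].
by move=> /andP[/andP[_ ->] /andP[_ ->]].
Qed.

Definition cube m n (N : nat) : set (mxspace R m n) :=
  mxbox (const_mx (- N%:R)) (const_mx N%:R).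

Lemma in_cube m n N (Y : mxspace R m n) :
  @cube m n N Y <-> forall i j, `|(Y : 'M[R]_(m, n)) i j| <= N%:R.
Proof.
by split=> h i j; have := h i j; rewrite !mxE ler_norml.
Qed.

Lemma bigcup_cube m n : \bigcup_N @cube m n N = setT.
Proof.
apply/seteqP; split => // Y _.
pose M := \sum_i \sum_j `|(Y : 'M[R]_(m, n)) i j|.
exists (Num.bound M) => //; apply/in_cube => i j.
have M0 : 0 <= M by do 2!apply: sumr_ge0 => ? _.
apply: le_trans (ltW (archi_boundP M0)).
rewrite /M (bigD1 i)//= (bigD1 j)//= -addrA lerDl addr_ge0//.
  by apply: sumr_ge0.
by do 2!apply: sumr_ge0 => ? _.
Qed.

Lemma measurable_cube m n N : measurable (@cube m n N).
Proof. exact: measurable_mxbox. Qed.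

(** The generators are bounded boxes, so the half-space [x <= Y i j] is exhausted by boxes whose
    other bounds are [-N] and [N]. *)
Lemma measurable_entry m n i j :
  measurable_fun setT (fun Y : mxspace R m n => (Y : 'M[R]_(m, n)) i j).
Proof.
apply: (measurability _ (RGenCInfty.measurableE R)) => _ [_ [x ->] <-].
rewrite setTI.
rewrite (_ : _ @^-1` _ = \bigcup_N (mxbox
   (\matrix_(i', j') if (i' == i) && (j' == j) then x else - N%:R)
   (const_mx N%:R) : set (mxspace R m n))); last first.
  apply/seteqP; split => Y /=.
    rewrite in_itv/= andbT => xY.
    have : [set: mxspace R m n] Y by [].
    rewrite -bigcup_cube => -[N _ /in_cube hN]; exists N => // i' j'.
    rewrite !mxE; have := hN i' j'; rewrite ler_norml.
    by case: ifP => // /andP[/eqP-> /eqP->] /andP[_ ->]; rewrite xY.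
  move=> [N _ /(_ i j)]; rewrite !mxE !eqxx/= => /andP[xY _].
  by rewrite in_itv/= xY.
by apply: bigcupT_measurable => N; exact: measurable_mxbox.
Qed.

Lemma measurable_to_mxspace d (T : measurableType d) m n
    (F : T -> mxspace R m n) :
  (forall i j, measurable_fun setT (fun x => (F x : 'M[R]_(m, n)) i j)) ->
  measurable_fun setT F.
Proof.
move=> mF; apply: (measurability _ (mxspace_measurableE m n)) => _ [_ [a [b ->]] <-].
rewrite setTI (_ : _ @^-1` _ = \bigcap_(i in [set: 'I_m]) \bigcap_(j in [set: 'I_n])
   ((fun x => (F x : 'M[R]_(m, n)) i j) @^-1` `[a i j, b i j])); last first.
  apply/seteqP; split => x /=.
    by move=> h i _ j _ /=; rewrite in_itv/=; exact: h.
  by move=> h i j; have := h i I j I; rewrite /= in_itv.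
apply: fin_bigcap_measurable => [|i _]; first exact: finite_finset.
apply: fin_bigcap_measurable => [|j _]; first exact: finite_finset.
by rewrite -[X in measurable X]setTI; exact: (mF i j).
Qed.

Lemma measurable_col_mx m1 m2 n :
  measurable_fun setT (fun p : mxspace R m1 n * mxspace R m2 n =>
    (col_mx p.1 p.2 : mxspace R (m1 + m2) n)).
Proof.
apply: measurable_to_mxspace => i j; have [k ->|k ->] := split_ordP i.
  under eq_fun do rewrite col_mxEu.
  exact: measurableT_comp (measurable_entry k j) measurable_fst.
under eq_fun do rewrite col_mxEd.
exact: measurableT_comp (measurable_entry k j) measurable_snd.
Qed.

Lemma measurable_usubmx m1 m2 n :
  measurable_fun setT (fun Y : mxspace R (m1 + m2) n =>
    (usubmx Y : mxspace R m1 n)).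
Proof.
apply: measurable_to_mxspace => i j.
under eq_fun do rewrite mxE.
exact: measurable_entry.
Qed.

Lemma measurable_dsubmx m1 m2 n :
  measurable_fun setT (fun Y : mxspace R (m1 + m2) n =>
    (dsubmx Y : mxspace R m2 n)).
Proof.
apply: measurable_to_mxspace => i j.
under eq_fun do rewrite mxE.
exact: measurable_entry.
Qed.

Lemma measurable_row m n i :
  measurable_fun setT (fun Y : mxspace R m n => (row i (Y : 'M[R]_(m, n)) : mxspace R 1 n)).
Proof.
apply: measurable_to_mxspace => i' j.
under eq_fun do rewrite mxE.
exact: measurable_entry.
Qed.

Lemma measurable_affine m n (A : 'M[R]_(m, n)) (r : R) :
  measurable_fun setT (fun Y : mxspace R m n => (A + r *: (Y : 'M[R]_(m, n)) : mxspace R m n)).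
Proof.
apply: measurable_to_mxspace => i j.
under eq_fun do rewrite !mxE.
apply: measurable_funD => //; apply: measurable_funM => //.
exact: measurable_entry.
Qed.

(* Degenerate boxes are empty, so only honest boxes need to be compared. *)
Lemma mxspace_measure_unique m n
    (m1 m2 : {measure set (mxspace R m n) -> \bar R}) :
  (forall N, (m1 (@cube m n N) < +oo)%E) ->
  (forall a b : 'M[R]_(m, n), (forall i j, a i j <= b i j) ->
     m1 (mxbox a b) = m2 (mxbox a b)) ->
  forall A, measurable A -> m1 A = m2 A.
Proof.
move=> fin eqb A mA.
apply: (@measure_unique _ R (mxspace R m n) (@mxboxes R m n) (@cube m n)) => //.
- exact: setI_closed_mxboxes.
- by move=> N; do 2!eexists.
- exact: bigcup_cube.
move=> _ [a [b ->]].
have [ab|nab] := pselect (forall i j, a i j <= b i j); first exact: eqb.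
rewrite (_ : mxbox a b = set0) ?measure0//.
apply/seteqP; split=> // Y h; apply: nab => i j.
by have /andP[aY Yb] := h i j; exact: le_trans Yb.
Qed.

Lemma lebesgue_cube m n (L : {measure set (mxspace R m n) -> \bar R}) N :
  is_lebesgue L -> (L (@cube m n N) < +oo)%E.
Proof.
move=> hL; rewrite /cube hL ?ltry// => i j.
by rewrite !mxE (@le_trans _ _ 0)// oppr_le0.
Qed.

Lemma lebesgue_sigma_finite m n (L : {measure set (mxspace R m n) -> \bar R}) :
  is_lebesgue L -> sigma_finite setT L.
Proof.
move=> hL; exists (@cube m n); first by rewrite bigcup_cube.
by move=> N; split; [exact: measurable_cube|exact: lebesgue_cube].
Qed.

Lemma lebesgue_unique m n (L L' : {measure set (mxspace R m n) -> \bar R}) :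
  is_lebesgue L -> is_lebesgue L' ->
  forall A, measurable A -> L A = L' A.
Proof.
move=> hL hL'; apply: mxspace_measure_unique.
  by move=> N; exact: lebesgue_cube.
by move=> a b ab; rewrite hL ?hL'.
Qed.

End MatrixSpace.

(** * Products and scalings of Lebesgue measure *)

Definition push d d' (T1 : measurableType d) (T2 : measurableType d')
    (R : realType) (m : {measure set T1 -> \bar R}) (f : T1 -> T2)
    (mf : measurable_fun setT f) : {measure set T2 -> \bar R} :=
  measure_function_pushforward__canonical__measure_function_Measure m mf.

(* The unused proof arguments of [sflebesgue], and of [dens] and [moment] below, are
   what the canonical measure instances recover their hypotheses from. *)
Definition sflebesgue (R : realType) m n
    (L : {measure set (mxspace R m n) -> \bar R}) (_ : is_lebesgue L) :
  set (mxspace R m n) -> \bar R := L.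

HB.instance Definition _ (R : realType) m n
    (L : {measure set (mxspace R m n) -> \bar R}) (hL : is_lebesgue L) :=
  Measure.copy (sflebesgue hL) L.

HB.instance Definition _ (R : realType) m n
    (L : {measure set (mxspace R m n) -> \bar R}) (hL : is_lebesgue L) :=
  @Measure_isSigmaFinite.Build _ _ _ (sflebesgue hL) (lebesgue_sigma_finite hL).

Section LebesgueProduct.
Variables (R : realType) (m1 m2 n : nat).
Variables (L1 : {measure set (mxspace R m1 n) -> \bar R}) (hL1 : is_lebesgue L1).
Variables (L2 : {measure set (mxspace R m2 n) -> \bar R}) (hL2 : is_lebesgue L2).

Definition lebesgue_col : {measure set (mxspace R (m1 + m2) n) -> \bar R} :=
  push (sflebesgue hL1 \x sflebesgue hL2)%E (@measurable_col_mx R m1 m2 n).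

(** A box on stacked rows is the product of the boxes on its two blocks, and the product measure
    multiplies their volumes. *)
Lemma is_lebesgue_col : is_lebesgue lebesgue_col.
Proof.
move=> a b ab.
rewrite /lebesgue_col /push/= /pushforward.
rewrite (_ : _ @^-1` _ = (mxbox (usubmx a) (usubmx b) : set (mxspace R m1 n)) `*`
   (mxbox (dsubmx a) (dsubmx b) : set (mxspace R m2 n))); last first.
  apply/seteqP; split => -[Y1 Y2] /=.
    move=> h; split => i j; rewrite !mxE.
      by have := h (lshift m2 i) j; rewrite /= col_mxEu.
    by have := h (rshift m1 i) j; rewrite /= col_mxEd.
  move=> [h1 h2] i j; have [k ->|k ->] := split_ordP i.
    by have := h1 k j; rewrite /= col_mxEu !mxE.
  by have := h2 k j; rewrite /= col_mxEd !mxE.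
have ab1 i j : usubmx a i j <= usubmx b i j by rewrite !mxE.
have ab2 i j : dsubmx a i j <= dsubmx b i j by rewrite !mxE.
rewrite product_measure1E; [|exact: measurable_mxbox..].
rewrite /sflebesgue hL1// hL2// -EFinM big_split_ord/=.
congr (_ * _)%:E; apply: eq_bigr => i _; apply: eq_bigr => j _; by rewrite !mxE.
Qed.

Variables (L : {measure set (mxspace R (m1 + m2) n) -> \bar R}) (hL : is_lebesgue L).
Variables (F : mxspace R (m1 + m2) n -> \bar R).
Hypotheses (mF : measurable_fun setT F) (F0 : forall Y, (0 <= F Y)%E).

Let mFc : measurable_fun setT (fun p : mxspace R m1 n * mxspace R m2 n => F (col_mx p.1 p.2)).
Proof. exact: measurableT_comp mF (@measurable_col_mx R m1 m2 n). Qed.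

(** By uniqueness [L] is the image of the product measure under stacking, so Tonelli's theorem for
    sigma-finite measures applies. *)
Lemma lebesgue_tonelli :
  (\int[L]_Y F Y = \int[L1]_x \int[L2]_Y F (col_mx x Y))%E.
Proof.
rewrite (eq_measure_integral lebesgue_col); last first.
  by move=> A mA _; apply: lebesgue_unique => //; exact: is_lebesgue_col.
rewrite ge0_integral_pushforward//; last exact: measurable_col_mx.
rewrite preimage_setT.
exact: (@fubini_tonelli1 _ _ _ _ _ (sflebesgue hL1) (sflebesgue hL2)
  (fun p => F (col_mx p.1 p.2)) mFc (fun p => F0 _)).
Qed.

End LebesgueProduct.

Section LebesgueAux.
Variable R : realType.

(** Lebesgue measure is given for single points and for k-tuples, whereas tuples of k+1 and k+2
    points are integrated; rows are added one at a time. *)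
Lemma exists_lebesgue n (lam : {measure set (mxspace R 1 n) -> \bar R}) :
  is_lebesgue lam ->
  forall m, exists L : {measure set (mxspace R m n) -> \bar R}, is_lebesgue L.
Proof.
move=> hlam; elim=> [|m [L hL]]; last first.
  by exists (lebesgue_col hlam hL); exact: (is_lebesgue_col hlam hL).
(* There is a single matrix without rows, and the volume of its box is the empty product 1. *)
exists (@dirac _ (mxspace R 0 n) (0 : 'M[R]_(0, n)) R : {measure set _ -> \bar R}).
move=> a b _; rewrite big_ord0 /= /dirac indicE mem_set//.
by case.
Qed.

(** Pulling a box back divides each of its [m * n] sides by [r], so [r ^+ (m * n)] times the image
    of [L] is again Lebesgue measure. The case [r = 1] is translation invariance. *)
Lemma lebesgue_affine m n (L : {measure set (mxspace R m n) -> \bar R})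
    (A : 'M[R]_(m, n)) (r : R) (F : mxspace R m n -> \bar R) :
  is_lebesgue L -> 0 < r -> measurable_fun setT F -> (forall Y, (0 <= F Y)%E) ->
  ((r ^+ (m * n))%:E * \int[L]_Z F (A + r *: (Z : 'M[R]_(m, n)))%R
     = \int[L]_Y F Y)%E.
Proof.
move=> hL r0 mF F0.
have rmn0 : 0 <= r ^+ (m * n) by apply/exprn_ge0/ltW.
pose L' := mscale (NngNum rmn0) (push L (measurable_affine A r)).
rewrite [RHS](eq_measure_integral L'); last first.
  move=> B mB _; apply: lebesgue_unique => // a b ab.
  rewrite /L' /= /mscale/= /push/= /pushforward.
  rewrite (_ : _ @^-1` _ = (mxbox (r^-1 *: (a - A)) (r^-1 *: (b - A)) : set (mxspace R m n))); last first.
    apply/seteqP; split => Y /= h i j; have := h i j; rewrite !mxE;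
      rewrite ![r^-1 * _]mulrC ler_pdivrMr// ler_pdivlMr// lerBlDl lerBrDl;
      by rewrite ![Y i j * r]mulrC.
  rewrite hL; last first.
    by move=> i j; rewrite !mxE ler_pM2l ?invr_gt0// lerD2r.
  rewrite -EFinM; congr _%:E.
  transitivity (\prod_(i < m) \prod_(j < n) (r * (r^-1 * (b i j - a i j)))).
    under [in RHS]eq_bigr do rewrite big_split/= prodr_const card_ord.
    rewrite big_split/= prodr_const card_ord -exprM mulnC; congr (_ * _).
    by apply: eq_bigr => i _; apply: eq_bigr => j _; rewrite !mxE; ring.
  apply: eq_bigr => i _; apply: eq_bigr => j _.
  by rewrite mulrA divff ?mul1r// gt_eqF.
rewrite ge0_integral_mscale//; congr (_ * _)%E.
by rewrite (ge0_integral_pushforward (measurable_affine A r))// preimage_setT.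
Qed.

End LebesgueAux.

(** * Densities and product densities on tuples of points *)

Lemma integral_in_indic d (T : measurableType d) (R : realType)
    (mu : {measure set T -> \bar R}) (A : set T) (g : T -> R) :
  (\int[mu]_(x in A) (g x)%:E = \int[mu]_x (g x * \1_A x)%:E)%E.
Proof. by rewrite integral_mkcond epatch_indic. Qed.

Section DensityMeasure.
Context d (T : measurableType d) (R : realType).
Variables (mu : {measure set T -> \bar R}) (g : T -> R).
Hypotheses (mg : measurable_fun setT g) (g0 : forall x, 0 <= g x).

Definition dens (_ : measurable_fun setT g) (_ : forall x, 0 <= g x) (A : set T) : \bar R :=
  (\int[mu]_(x in A) (g x)%:E)%E.

Let dens0 : dens mg g0 set0 = 0%E.
Proof. exact: integral_set0. Qed.

Let dens_ge0 A : (0 <= dens mg g0 A)%E.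
Proof. by apply: integral_ge0 => x _; rewrite lee_fin. Qed.

Let dens_sigma_additive : semi_sigma_additive (dens mg g0).
Proof.
move=> F mF tF mUF; rewrite /dens ge0_integral_bigcup//; last 2 first.
  by apply/measurable_EFinP; apply: measurable_funTS.
  by move=> x _; rewrite lee_fin.
apply: is_cvg_ereal_nneg_natsum_cond => n _ _.
by apply: integral_ge0 => x _; rewrite lee_fin.
Qed.

HB.instance Definition _ := isMeasure.Build _ _ _
  (dens mg g0) dens0 dens_ge0 dens_sigma_additive.

End DensityMeasure.

Section ProductDensity.
Variables (R : realType) (n : nat).
Variables (lam : {measure set (mxspace R 1 n) -> \bar R}) (hlam : is_lebesgue lam).

Lemma measurable_prod_rows m (g : 'I_m -> mxspace R 1 n -> R) :
  (forall i, measurable_fun setT (g i)) ->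
  measurable_fun setT (fun Y : mxspace R m n => \prod_i g i (row i (Y : 'M[R]_(m, n)))).
Proof.
move=> mg; apply: measurable_prod => i _.
exact: measurableT_comp (mg i) (measurable_row i).
Qed.

(** Induction on the rows: Tonelli splits off the first row, whose factor is constant in the inner
    integral. *)
Lemma integral_prod_rows m (L : {measure set (mxspace R m n) -> \bar R})
    (hL : is_lebesgue L) (g : 'I_m -> mxspace R 1 n -> R) :
  (forall i, measurable_fun setT (g i)) -> (forall i x, 0 <= g i x) ->
  (\int[L]_Y (\prod_i g i (row i (Y : 'M[R]_(m, n))))%:E
     = \big[*%E/1]_(i < m) \int[lam]_x (g i x)%:E)%E.
Proof.
elim: m L hL g => [|m IH] L hL g mg g0.
  under eq_integral do rewrite big_ord0.
  rewrite big_ord0 integral_cst// mul1e.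
  rewrite (_ : setT = mxbox (0 : 'M[R]_(0, n)) 0); last first.
    by apply/esym/seteqP; split=> // Y _ [].
  by rewrite hL ?big_ord0// => -[].
have [L' hL'] := exists_lebesgue hlam m.
rewrite (@lebesgue_tonelli R 1 m n _ hlam _ hL' L hL); last 2 first.
  by apply/measurable_EFinP; exact: (@measurable_prod_rows m.+1 g).
  by move=> Y; rewrite lee_fin prodr_ge0.
rewrite big_ord_recl -(IH _ hL' (fun i => g (lift ord0 i)))//.
have E (x : mxspace R 1 n) (Y : mxspace R m n) :
    \prod_i g i (row i (col_mx x Y : 'M[R]_(1 + m, n))) =
    g ord0 x * \prod_i g (lift ord0 i) (row i (Y : 'M[R]_(m, n))).
  rewrite big_ord_recl; congr (_ * _).
    congr g; transitivity (row (ord0 : 'I_1) (x : 'M[R]_(1, n))); last exact: row_id.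
    by rewrite -[RHS](rowKu (ord0 : 'I_1) x Y); congr row; apply: ord_inj.
  apply: eq_bigr => i _; congr g.
  by rewrite -[RHS](rowKd i x Y); congr row; apply: ord_inj.
under eq_integral => x _.
  under eq_integral do rewrite E EFinM.
  rewrite ge0_integralZl_EFin//; last 2 first.
    by move=> Y _; rewrite lee_fin prodr_ge0.
    by apply/measurable_EFinP; exact: (@measurable_prod_rows m (fun i => g (lift ord0 i))).
  rewrite muleC; over.
rewrite ge0_integralZl//.
- by rewrite muleC.
- exact/measurable_EFinP.
- by move=> x _; rewrite lee_fin.
- by apply: integral_ge0 => Y _; rewrite lee_fin prodr_ge0.
Qed.

Lemma lebesgue_tonelli_swap m1 m2
    (L1 : {measure set (mxspace R m1 n) -> \bar R}) (hL1 : is_lebesgue L1)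
    (L2 : {measure set (mxspace R m2 n) -> \bar R}) (hL2 : is_lebesgue L2)
    (F : mxspace R m1 n * mxspace R m2 n -> \bar R) :
  measurable_fun setT F -> (forall p, (0 <= F p)%E) ->
  (\int[L1]_x \int[L2]_Y F (x, Y) = \int[L2]_Y \int[L1]_x F (x, Y))%E.
Proof.
move=> mF F0.
exact: (@fubini_tonelli _ _ _ _ R (sflebesgue hL1) (sflebesgue hL2)).
Qed.

Variables (f : mxspace R 1 n -> R).
Hypotheses (mf : measurable_fun setT f) (f0 : forall x, 0 <= f x).

Definition pdens m (Y : mxspace R m n) : R := \prod_(i < m) f (row i (Y : 'M[R]_(m, n))).

Lemma measurable_pdens m : measurable_fun setT (@pdens m).
Proof. exact: (@measurable_prod_rows m (fun=> f)). Qed.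

Lemma pdens_ge0 m Y : 0 <= @pdens m Y.
Proof. exact: prodr_ge0. Qed.

Lemma pdens_col m (x : mxspace R 1 n) (Y : mxspace R m n) :
  pdens (col_mx x Y : mxspace R (1 + m) n) = f x * pdens Y.
Proof.
rewrite /pdens big_split_ord/= big_ord1; congr (_ * _).
  by rewrite rowKu row_id.
by apply: eq_bigr => i _; rewrite rowKd.
Qed.

Lemma dens_rows m (L : {measure set (mxspace R m n) -> \bar R})
    (hL : is_lebesgue L) (A : 'I_m -> set (mxspace R 1 n)) :
  (forall i, measurable (A i)) ->
  (\int[L]_(Y in [set Y : mxspace R m n | forall i, A i (row i (Y : 'M[R]_(m, n)))]) (pdens Y)%:E
     = \big[*%E/1]_(i < m) \int[lam]_(x in A i) (f x)%:E)%E.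
Proof.
move=> mA; rewrite integral_in_indic.
under [RHS]eq_bigr do rewrite integral_in_indic.
rewrite -(@integral_prod_rows m L hL (fun i x => f x * \1_(A i) x)); last 2 first.
- by move=> i; apply: measurable_funM => //; exact: measurable_indic.
- by move=> i x; rewrite mulr_ge0.
- apply: eq_integral => Y _; congr _%:E; rewrite big_split/=; congr (_ * _).
  have [h|h] := pselect (forall i, A i (row i (Y : 'M[R]_(m, n)))).
    by rewrite big1 ?indicE ?mem_set// => i _; rewrite indicE mem_set//; exact: h.
  have [i hi] : exists i, ~ A i (row i (Y : 'M[R]_(m, n))) by exact/existsNP.
  by rewrite (bigD1 i)//= !indicE !memNset// mul0r.
Qed.

End ProductDensity.

(** * Continuity of translations in L1 *)

Lemma cvg_prodr (R : realType) (I : Type) (s : seq I) (u : I -> nat -> R) (l : I -> R) :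
  (forall i, u i @ \oo --> l i) ->
  (fun n => \prod_(i <- s) u i n) @ \oo --> \prod_(i <- s) l i.
Proof.
move=> ul; elim: s => [|i s IH].
  by rewrite big_nil; under eq_fun do rewrite big_nil; exact: cvg_cst.
by rewrite big_cons; under eq_fun do rewrite big_cons; exact: cvgM.
Qed.

Lemma cvge_lt_near (R : realType) (u : nat -> \bar R) (l e : R) :
  u @ \oo --> l%:E -> l < e -> \forall k \near \oo, (u k < e%:E)%E.
Proof.
move=> /fine_cvgP[ufin ul] le_le; near=> k.
rewrite -(@fineK _ (u k)); last by near: k.
by rewrite lte_fin; near: k; exact: (cvgr_lt l).
Unshelve. all: by end_near. Qed.

Section BoxVolume.
Variables (R : realType) (m n : nat).
Variables (L : {measure set (mxspace R m n) -> \bar R}) (hL : is_lebesgue L).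

(** Truncating the sides at 0 covers empty boxes and keeps the formula continuous in the corners;
    the intersection of a box with its translate will need both. *)
Lemma lebesgue_mxbox (a b : 'M[R]_(m, n)) :
  L (mxbox a b) = (\prod_i \prod_j Num.max 0 (b i j - a i j))%:E.
Proof.
have [ab|] := pselect (forall i j, a i j <= b i j).
  rewrite hL//; congr _%:E; apply: eq_bigr => i _; apply: eq_bigr => j _.
  by rewrite max_r// subr_ge0.
move=> /existsNP[i /existsNP[j /negP]]; rewrite -ltNge => ba.
rewrite (_ : mxbox a b = set0); last first.
  apply/seteqP; split => // Y /(_ i j) /andP[h1 h2].
  by have := lt_le_trans ba (le_trans h1 h2); rewrite ltxx.
rewrite measure0 (bigD1 i)//= (bigD1 j)//= max_l ?mul0r//.
by rewrite subr_le0 ltW.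
Qed.

End BoxVolume.

Section TranslationContinuity.
Variables (R : realType) (m n : nat).
Variables (L : {measure set (mxspace R m n) -> \bar R}) (hL : is_lebesgue L).
Local Notation E := (mxspace R m n).
Local Notation M := 'M[R]_(m, n).

Lemma measurable_shift (d' : measure_display) (T : measurableType d') (g : E -> T) (v : M) :
  measurable_fun setT g -> measurable_fun setT (fun x : E => g (v + (x : M))).
Proof.
move=> mg.
have -> : (fun x : E => g (v + (x : M))) = g \o (fun x : E => v + 1 *: (x : M) : E).
  by apply/funext => x /=; rewrite scale1r.
exact: measurableT_comp mg (measurable_affine v 1).
Qed.

Lemma integral_shift (F : E -> \bar R) (v : M) :
  measurable_fun setT F -> (forall x, (0 <= F x)%E) ->
  (\int[L]_x F (v + (x : M))%R = \int[L]_x F x)%E.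
Proof.
move=> mF F0; rewrite -(lebesgue_affine v hL ltr01 mF F0) expr1n mul1e.
by apply: eq_integral => x _; rewrite scale1r.
Qed.

Implicit Types (g : E -> R) (v : M).

Definition modulus (g : E -> R) (v : M) : \bar R :=
  (\int[L]_x `|g (v + (x : M))%R - g x|%:E)%E.

Lemma modulus_ge0 g v : (0 <= modulus g v)%E.
Proof. by apply: integral_ge0 => x _; rewrite lee_fin. Qed.

Let mabs (g : E -> R) : measurable_fun setT g -> measurable_fun setT (fun x => `|g x|%:E).
Proof. by move=> mg; apply/measurable_EFinP; exact: measurableT_comp. Qed.

Let mmod (g : E -> R) v : measurable_fun setT g ->
  measurable_fun setT (fun x : E => `|g (v + (x : M)) - g x|%:E).
Proof. by move=> mg; apply: mabs; apply: measurable_funB => //; exact: measurable_shift. Qed.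

Lemma modulusD g1 g2 v : measurable_fun setT g1 -> measurable_fun setT g2 ->
  (modulus (fun x => g1 x + g2 x)%R v <= modulus g1 v + modulus g2 v)%E.
Proof.
move=> mg1 mg2; rewrite /modulus -ge0_integralD//; [|exact: mmod..].
apply: ge0_le_integral => //.
- by apply: mmod; exact: measurable_funD.
- by apply: emeasurable_funD; exact: mmod.
move=> x _; rewrite -EFinD lee_fin opprD addrACA; exact: ler_normD.
Qed.

Lemma modulusZ c g v : measurable_fun setT g ->
  modulus (fun x => c * g x)%R v = (`|c|%:E * modulus g v)%E.
Proof.
move=> mg; rewrite /modulus -ge0_integralZl_EFin//; last exact: mmod.
by apply: eq_integral => x _; rewrite -mulrBr normrM EFinM.
Qed.

(** Triangle inequality and translation invariance. The bound is uniform in [v], which lets errors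
    of L1 approximation pass through any shift. *)
Lemma modulus_le g v : measurable_fun setT g ->
  (modulus g v <= 2%:E * \int[L]_x `|g x|%:E)%E.
Proof.
move=> mg; rewrite (_ : 2%:E = 1 + 1)%E// ge0_muleDl// mul1e.
rewrite -{1}(integral_shift v (mabs mg))// -ge0_integralD//; last 2 first.
- by apply: (measurable_shift v (mabs mg)).
- exact: mabs.
apply: ge0_le_integral => //; first exact: mmod.
  by apply: emeasurable_funD; [exact: (measurable_shift v (mabs mg))|exact: mabs].
by move=> x _; rewrite -EFinD lee_fin ler_normB.
Qed.

Variables (h : nat -> M) (hh : forall i j, (fun k => h k i j) @ \oo --> 0).

(** Continuity along the one null sequence [h], which will be [r n] times a fixed vector.
    Measurability is bundled so that the class is stable under sums, multiples and limits. *)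
Definition l1_continuous (g : E -> R) := measurable_fun setT g /\
  forall e : R, 0 < e -> \forall k \near \oo, (modulus g (h k) <= e%:E)%E.

Lemma l1_continuousD g1 g2 : l1_continuous g1 -> l1_continuous g2 ->
  l1_continuous (fun x => g1 x + g2 x).
Proof.
move=> [mg1 c1] [mg2 c2]; split; first exact: measurable_funD.
move=> e e0; have e20 : 0 < e / 2 by rewrite divr_gt0.
near=> k; apply: (le_trans (modulusD _ mg1 mg2)).
rewrite (splitr e) EFinD; apply: leeD; near: k; [exact: c1|exact: c2].
Unshelve. all: by end_near. Qed.

Lemma l1_continuousZ c g : l1_continuous g -> l1_continuous (fun x => c * g x).
Proof.
move=> [mg cg]; split; first exact: measurable_funM.
move=> e e0.
have c0 : 0 < `|c| + 1 by rewrite ltr_wpDl.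
have e0' : 0 < e / (`|c| + 1) by rewrite divr_gt0.
near=> k; rewrite modulusZ//.
apply: (@le_trans _ _ ((`|c| + 1)%:E * (e / (`|c| + 1))%:E)%E).
  apply: lee_pmul => //; first exact: modulus_ge0.
    by rewrite lee_fin lerDl.
  by near: k; exact: cg.
by rewrite -EFinM lee_fin mulrCA divff ?mulr1// gt_eqF.
Unshelve. all: by end_near. Qed.

Lemma l1_continuous0 : l1_continuous (fun=> 0).
Proof.
split=> // e e0; near=> k; rewrite /modulus.
by under eq_integral do rewrite subrr normr0; rewrite integral0 lee_fin ltW.
Unshelve. all: by end_near. Qed.

Lemma l1_continuous_sum (I : Type) (s : seq I) (g : I -> E -> R) :
  (forall i, l1_continuous (g i)) -> l1_continuous (fun x => \sum_(i <- s) g i x).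
Proof.
move=> cg; elim: s => [|i s IH].
  by under eq_fun do rewrite big_nil; exact: l1_continuous0.
by under eq_fun do rewrite big_cons; exact: l1_continuousD.
Qed.

(** Write [g] as [g_ N] plus the remainder: the modulus of [g_ N] vanishes along [h], and that of
    the remainder is at most twice its L1 norm whatever the shift. Hence the tolerance [e / 4]. *)
Lemma l1_continuous_closed (g : E -> R) (g_ : nat -> E -> R) :
  measurable_fun setT g -> (forall N, l1_continuous (g_ N)) ->
  (fun N => \int[L]_x `|(g_ N x)%:E - (g x)%:E|)%E @ \oo --> 0%E ->
  l1_continuous g.
Proof.
move=> mg cg gcvg; split => // e e0.
have e40 : 0 < e / 4 by rewrite divr_gt0.
have : \forall N \near \oo, ((\int[L]_x `|(g_ N x)%:E - (g x)%:E|)%E < (e / 4)%:E)%E.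
  exact: (cvge_lt_near gcvg).
move=> [N _ /(_ N (leqnn N)) Ne].
have [mgN cgN] := cg N.
have mD : measurable_fun setT (fun x => (-1) * g_ N x + g x).
  by apply: measurable_funD => //; exact: measurable_funM.
near=> k.
have -> : g = (fun x => g_ N x + ((-1) * g_ N x + g x)).
  by apply/funext => x; rewrite mulN1r addrA subrr add0r.
apply: (le_trans (modulusD _ mgN mD)).
rewrite (splitr e) EFinD; apply: leeD.
  by near: k; apply: cgN; rewrite divr_gt0.
apply: (le_trans (modulus_le _ mD)).
apply: (@le_trans _ _ (2%:E * (e / 4)%:E)%E).
  apply: lee_wpmul2l => //.
  rewrite (eq_integral (fun x => `|(g_ N x)%:E - (g x)%:E|)%E) ?ltW//.
  by move=> x _; rewrite -EFinB abse_EFin -normrN; congr (`|_|%:E); ring.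
by rewrite -EFinM lee_fin; lra.
Unshelve. all: by end_near. Qed.

Lemma l1_continuous_dominated (g G : E -> R) (g_ : nat -> E -> R) :
  measurable_fun setT g -> (forall N, l1_continuous (g_ N)) ->
  (forall x, (fun N => g_ N x) @ \oo --> g x) ->
  L.-integrable setT (EFin \o G) -> (forall N x, `|g_ N x| <= G x) ->
  l1_continuous g.
Proof.
move=> mg cg gcvg iG le_gG; apply: (l1_continuous_closed mg cg).
have [] := @dominated_convergence _ _ _ L setT measurableT
  (fun N => EFin \o g_ N) (EFin \o g) (EFin \o G).
- by move=> N; apply/measurable_EFinP; exact: (cg N).1.
- exact/measurable_EFinP.
- by apply: aeW => x _; apply: cvg_EFin; [exact: nearW|exact: gcvg].
- exact: iG.
- by apply: aeW => x N _; rewrite lee_fin.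
by [].
Qed.

(** The points of a box that stay in it after a shift by [v] form a box whose sides are shorter by
    [|v i j|]. The modulus is twice the loss of volume, which is continuous in [v]. *)
Lemma l1_continuous_mxbox a b : l1_continuous \1_(mxbox a b : set E).
Proof.
split; first by apply: measurable_indic; exact: measurable_mxbox.
pose V t := \prod_i \prod_j Num.max 0 (b i j - a i j - t i j) : R.
have E1 v : modulus \1_(mxbox a b : set E) v = (2 * (V (fun _ _ => 0) - V (fun i j => `|v i j|)))%:E.
  rewrite /modulus.
  pose B := mxbox a b : set E.
  pose B' := mxbox (\matrix_(i, j) Num.max (a i j) (a i j - v i j))
                  (\matrix_(i, j) Num.min (b i j) (b i j - v i j)) : set E.
  have mB : measurable B := measurable_mxbox a b.
  have mB' : measurable B' by exact: measurable_mxbox.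
  have IB : (\int[L]_x (\1_B x)%:E)%E = (V (fun _ _ => 0))%:E.
    rewrite integral_indic// setIT (lebesgue_mxbox hL).
    by congr _%:E; apply: eq_bigr => i _; apply: eq_bigr => j _; rewrite subr0.
  have IB' : (\int[L]_x (\1_B' x)%:E)%E = (V (fun i j => `|v i j|))%:E.
    rewrite integral_indic// setIT (lebesgue_mxbox hL).
    congr _%:E; apply: eq_bigr => i _; apply: eq_bigr => j _; rewrite !mxE; congr Num.max.
    case: (ger0P (v i j)) => v0.
      by rewrite min_r ?max_l; lra.
    by rewrite min_l ?max_r; lra.
  have mV : measurable_fun setT (fun x : E => (\1_B x)%:E : \bar R).
    by apply/measurable_EFinP; exact: measurable_indic.
  have mV' : measurable_fun setT (fun x : E => (\1_B' x)%:E : \bar R).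
    by apply/measurable_EFinP; exact: measurable_indic.
  (* For s, t in {0, 1} one has |s - t| + 2 s t = s + t; the additive form avoids subtracting
     extended reals. *)
  have : ((\int[L]_x `|\1_B (v + (x : M))%R - \1_B x|%:E) + 2%:E * \int[L]_x (\1_B' x)%:E
     = (V (fun _ _ => 0))%:E + (V (fun _ _ => 0))%:E)%E.
    have IBv : (\int[L]_x (\1_B (v + (x : M))%R)%:E)%E = (V (fun _ _ => 0))%:E.
      by rewrite (integral_shift v mV).
    rewrite -{1}IBv -IB -ge0_integralD//; last exact: (measurable_shift v mV).
    rewrite -ge0_integralZl_EFin// -ge0_integralD//; last 2 first.
    - by apply: mmod; exact: measurable_indic.
    - exact: emeasurable_funM.
    apply: eq_integral => x _; rewrite -!EFinM -!EFinD; congr _%:E.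
    have -> : \1_B' x = \1_B (v + (x : M)) * \1_B x :> R.
      rewrite !indicE -natrM mulnb; congr (nat_of_bool _)%:R.
      apply/idP/andP; rewrite !inE.
        move=> hx; split => i j; have := hx i j;
          rewrite !mxE ge_max le_min => /andP[/andP[p q] /andP[p' q']].
          by apply/andP; split; lra.
        by rewrite p p'.
      move=> [hx hx'] i j; rewrite !mxE ge_max le_min.
      have := hx i j; have := hx' i j; rewrite mxE => /andP[p q] /andP[p' q'].
      by rewrite p q/=; apply/andP; split; lra.
    rewrite !indicE; do 2!case: (_ \in _);
      rewrite /= ?mulr1n ?mulr0n ?subrr ?subr0 ?sub0r ?normrN ?normr0 ?normr1; lra.
  rewrite IB' -EFinM -EFinD; case: (\int[L]_x _)%E => //= s [] E0.
  by congr _%:E; lra.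
have Vcvg : (fun k => 2 * (V (fun _ _ => 0) - V (fun i j => `|h k i j|))) @ \oo --> (0 : R).
  rewrite [X in _ --> X](_ : _ = 2 * (V (fun _ _ => 0) - V (fun _ _ => 0))); last by rewrite subrr mulr0.
  apply: cvgMr; apply: cvgB; first exact: cvg_cst.
  apply: (@cvg_prodr R _ _ (fun i k => \prod_j Num.max 0 (b i j - a i j - `|h k i j|))
    (fun i => \prod_j Num.max 0 (b i j - a i j - 0))) => i.
  apply: (@cvg_prodr R _ _ (fun j k => Num.max 0 (b i j - a i j - `|h k i j|))
    (fun j => Num.max 0 (b i j - a i j - 0))) => j.
  have max_cont : {for 0, continuous (fun t : R => Num.max 0 (b i j - a i j - t) : R)}.
    apply: (@continuous_max R R (fun=> 0) (fun t => b i j - a i j - t)).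
      exact: cvg_cst.
    by apply: cvgB; [exact: cvg_cst|exact: cvg_id].
  apply: (@continuous_cvg _ _ _ _ _ (fun k => `|h k i j|) _ _ max_cont).
  by rewrite -(@normr0 _ R); apply: cvg_norm; exact: hh.
move=> e e0; near=> k; rewrite E1 lee_fin.
apply: le_trans (ler_norm _) _; rewrite -normrN -[X in `|X|]add0r.
by near: k; move/cvgrPdist_le : Vcvg; exact.
Unshelve. all: by end_near. Qed.

Lemma integrable_cube_indic N : L.-integrable setT (EFin \o \1_(@cube R m n N)).
Proof.
apply/integrableP; split; first by apply/measurable_EFinP; apply: measurable_indic; exact: measurable_cube.
under eq_integral do rewrite /= ger0_norm//.
by rewrite integral_indic//; [rewrite setIT; exact: lebesgue_cube|exact: measurable_cube].
Qed.

(** Dynkin induction from boxes. Inside a cube every indicator is dominated by an integrable one, so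
    complements become differences and disjoint unions follow by dominated convergence. *)
Lemma l1_continuous_indic (A : set E) N : measurable A ->
  l1_continuous \1_(A `&` @cube R m n N).
Proof.
move=> mA.
have cC := l1_continuous_mxbox (const_mx (- N%:R)) (const_mx N%:R).
pose C := @cube R m n N; have mC : measurable C by exact: measurable_cube.
apply: (@dynkin_induction _ E (@mxboxes R m n) (fun A => l1_continuous \1_(A `&` C))) => //.
- exact: setI_closed_mxboxes.
- by rewrite setTI.
- move=> B Bbox; have /setI_closed_mxboxes : mxboxes C by do 2!eexists.
  move=> /(_ _ Bbox)[a [b ab]]; rewrite setIC ab; exact: l1_continuous_mxbox.
- move=> B mB cB.
  rewrite (_ : \1_(_ `&` C) = (fun x => \1_C x + (-1) * \1_(B `&` C) x)); last first.
    apply/funext => x; rewrite !indicE !in_setI in_setC.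
    by case: (x \in B); case: (x \in C); rewrite /=; lra.
  by apply: l1_continuousD => //; exact: l1_continuousZ.
- move=> F mF tF cF.
  apply: (@l1_continuous_dominated _ \1_C (fun k => \1_((\big[setU/set0]_(i < k) F i) `&` C))).
  + by apply: measurable_indic; apply: measurableI => //; exact: bigcup_measurable.
  + elim=> [|k IH]; first by rewrite big_ord0 set0I indic0; exact: l1_continuous0.
    rewrite (_ : \1_(_ `&` C) = (fun x => \1_((\big[setU/set0]_(i < k) F i) `&` C) x + \1_(F k `&` C) x)).
      exact: l1_continuousD.
    apply/funext => x; rewrite big_ord_recr/= !indicE !in_setI in_setU.
    have : ~~ ((x \in \big[setU/set0]_(i < k) F i) && (x \in F k)).
      apply/negP => /andP[]; rewrite !inE -bigcup_mkord => -[i /= ik Fi] Fk.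
      by have := tF i k I I (ex_intro _ x (conj Fi Fk)); lia.
    by case: (x \in \big[_/_]_(_ < _) _); case: (x \in F k); case: (x \in C) => //= _;
      rewrite ?addr0 ?add0r.
  + move=> x; have [[j _ Fj]|nF] := pselect ((\bigcup_k F k) x).
      apply: cvg_near_cst; near=> k; rewrite !indicE !in_setI; congr ((_ && _)%:R).
      rewrite !mem_set//; first by exists j.
      by rewrite -bigcup_mkord; exists j => //=; near: k; exact: nbhs_infty_gt.
    apply: cvg_near_cst; near=> k; rewrite !indicE !in_setI; congr ((_ && _)%:R).
    rewrite !memNset//; rewrite -bigcup_mkord => -[j _ Fj]; apply: nF; by exists j.
  + exact: integrable_cube_indic.
  + move=> k x; rewrite ger0_norm// !indicE in_setI ler_nat.
    by case: (x \in C); rewrite ?andbT ?andbF//; case: (_ \in _).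
Unshelve. all: by end_near. Qed.

Import HBSimple.

(** Simple functions are dense in L1. Their level sets may be unbounded, hence the second
    approximation by truncation to growing cubes, dominated by [|g N|]. *)
Lemma l1_continuous_integrable (f : E -> R) :
  L.-integrable setT (EFin \o f) -> l1_continuous f.
Proof.
move=> intf.
have mf : measurable_fun setT f by apply/measurable_EFinP; exact: measurable_int intf.
have [g [ig _ gcvg]] := approximation_sfun_integrable measurableT intf.
refine (@l1_continuous_closed f (fun N x => g N x) mf _ _); last first.
  apply: cvg_trans gcvg; apply: near_eq_cvg; near=> N.
  by apply: eq_integral => x _; rewrite -abseN oppeB// addeC.
move=> N; apply: (@l1_continuous_dominated _ (fun x => `|g N x|) (fun K x => g N x * \1_(@cube R m n K) x)).
- exact: measurable_funPT.
- move=> K.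
  have [s gs] : exists s : seq R,
      forall x, g N x = \sum_(y <- s) y * \1_(g N @^-1` [set y]) x.
    by exists (finmap.enum_fset (fset_set (range (g N)))) => x; rewrite {1}fimfunE fsbig_finite.
  rewrite (_ : (fun x => _) = (fun x => \sum_(y <- s)
     y * \1_((g N @^-1` [set y]) `&` @cube R m n K) x)).
    apply: l1_continuous_sum => y; apply: l1_continuousZ; apply: l1_continuous_indic.
    exact: measurable_funPTI.
  apply/funext => x; rewrite gs big_distrl/=.
  by apply: eq_bigr => y _; rewrite -mulrA !indicE in_setI -natrM mulnb.
- move=> x; apply: cvg_near_cst.
  have : [set: E] x by [].
  rewrite -bigcup_cube => -[K0 _ xK0]; near=> K.
  rewrite indicE mem_set ?mulr1//; apply/in_cube => i j.
  move/in_cube : xK0 => /(_ i j) /le_trans; apply; rewrite ler_nat; near: K.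
  exact: nbhs_infty_ge.
- exact: integrable_abse (ig N).
- move=> K x; rewrite normrM ler_piMr// indicE; by case: (_ \in _); rewrite ?normr0 ?normr1.
Unshelve. all: by end_near. Qed.

End TranslationContinuity.

(** * Circumcenters through Gram matrices *)

Section Circumcenter.
Variables (R : realType) (k d : nat).
Implicit Types (V : 'M[R]_(k, d)) (u v : 'rV[R]_d) (a : 'rV[R]_k) (y : 'I_k.+1 -> 'rV[R]_d).

Lemma sqr_enorm v : enorm v ^+ 2 = \sum_j v 0 j ^+ 2.
Proof. by rewrite sqr_sqrtr// sumr_ge0// => i _; exact: sqr_ge0. Qed.

Lemma sqr_enorm_mx v : enorm v ^+ 2 = (v *m v^T) 0 0.
Proof. by rewrite sqr_enorm mxE; apply: eq_bigr => j _; rewrite mxE expr2. Qed.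

Lemma enorm_ge0 v : 0 <= enorm v.
Proof. exact: sqrtr_ge0. Qed.

Lemma enorm0_eq0 v : enorm v = 0 -> v = 0.
Proof.
move=> v0; apply/rowP => j; rewrite mxE; apply/eqP; rewrite -sqrf_eq0.
have /eqP := sqr_enorm v; rewrite v0 expr0n eq_sym/= psumr_eq0.
  by move=> /allP /(_ j (mem_index_enum _)).
by move=> i _; exact: sqr_ge0.
Qed.

Lemma entry_le_enorm v j : `|v 0 j| <= enorm v.
Proof.
rewrite -(ler_pXn2r (ltn0Sn 1)) ?nnegrE ?enorm_ge0//.
rewrite sqr_enorm -normrX ger0_norm ?sqr_ge0// (bigD1 j)//= lerDl.
by apply: sumr_ge0 => i _; exact: sqr_ge0.
Qed.

Lemma enorm_scale r v : 0 <= r -> enorm (r *: v) = r * enorm v.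
Proof.
move=> r0; rewrite -[X in X * _](ger0_norm r0) -sqrtr_sqr -sqrtrM ?sqr_ge0//.
by rewrite mulr_sumr; congr Num.sqrt; apply: eq_bigr => j _; rewrite mxE exprMn.
Qed.

Definition gram V : 'M[R]_k := V *m V^T.

(** If [u] kills the Gram matrix, then [|u V|^2 = u (V V^T) u^T = 0]. Independence thus becomes the
    nonvanishing of a polynomial, although [V] need not be square. *)
Lemma row_free_gram V : row_free V = (gram V \in unitmx).
Proof.
rewrite -row_free_unit; apply/idP/idP => [Vfree|Gfree].
  rewrite -kermx_eq0; apply/eqP/row_matrixP => i; rewrite row0.
  set u := row i _.
  have uG : u *m gram V = 0 by apply/sub_kermxP; exact: row_sub.
  have uV0 : u *m V = 0.
    apply: enorm0_eq0; apply/eqP; rewrite -sqrf_eq0 sqr_enorm_mx trmx_mul mulmxA.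
    by rewrite -[u *m V *m V^T]mulmxA uG mul0mx mxE.
  by apply: (row_free_inj Vfree); rewrite uV0 mul0mx.
rewrite -kermx_eq0; apply/eqP/row_matrixP => i; rewrite row0.
set u := row i _.
have uV : u *m V = 0 by apply/sub_kermxP; exact: row_sub.
by apply: (row_free_inj Gfree); rewrite mulmxA uV !mul0mx.
Qed.

(* Barycentric coordinates, relative to the rows of [V], of the circumcenter of
   [0] and the rows of [V]: they solve [<a V, row i V> = |row i V|^2 / 2]. *)
Definition bary V : 'rV[R]_k :=
  2^-1 *: ((\row_i gram V i i) *m invmx (gram V)).

Definition edges y : 'M[R]_(k, d) := \matrix_(i < k) (y (lift ord0 i) - y ord0).

Lemma affine_combE y (l : 'I_k.+1 -> R) : \sum_i l i = 1 ->
  \sum_i l i *: y i = y ord0 + (\row_i l (lift ord0 i)) *m edges y.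
Proof.
move=> l1; rewrite mulmx_sum_row.
under [X in _ = _ + X]eq_bigr do rewrite rowK mxE scalerBr.
rewrite big_split/= sumrN -scaler_suml big_ord_recl addrA addrAC; congr (_ + _).
rewrite -[X in X - _]scale1r -scalerBl; congr (_ *: _).
by rewrite -l1 big_ord_recl addrK.
Qed.

Lemma enormB_sqr u v : enorm (u - v) ^+ 2 = enorm u ^+ 2 - 2 * (u *m v^T) 0 0 + enorm v ^+ 2.
Proof.
rewrite !sqr_enorm mxE mulr_sumr -sumrB -big_split/=.
by apply: eq_bigr => j _; rewrite !mxE; ring.
Qed.

Lemma enorm_eqP u v : enorm u = enorm v <-> enorm u ^+ 2 = enorm v ^+ 2.
Proof.
split=> [->//|/eqP]; rewrite eqrXn2 ?enorm_ge0//; by move=> /eqP.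
Qed.

(** Expanding [|w - v|^2 = |w|^2] cancels the quadratic term in [w]: equidistance is the linear
    system [<w, v_i> = |v_i|^2 / 2] over the edges [v_i]. *)
Lemma equidistantP y (w : 'rV[R]_d) :
  (forall i, enorm (y ord0 + w - y i) = enorm (y ord0 + w - y ord0)) <->
  w *m (edges y)^T = 2^-1 *: \row_i gram (edges y) i i.
Proof.
have E i : enorm (y ord0 + w - y (lift ord0 i)) = enorm (y ord0 + w - y ord0) <->
    (w *m (edges y)^T) 0 i = 2^-1 * gram (edges y) i i.
  have -> : y ord0 + w - y ord0 = w by rewrite addrC addKr.
  have -> : y ord0 + w - y (lift ord0 i) = w - row i (edges y).
    by rewrite rowK opprB addrA (addrC w).
  have -> : gram (edges y) i i = enorm (row i (edges y)) ^+ 2.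
    by rewrite sqr_enorm mxE; apply: eq_bigr => j _; rewrite !mxE expr2.
  have -> : (w *m (edges y)^T) 0 i = (w *m (row i (edges y))^T) 0 0.
    by rewrite !mxE; apply: eq_bigr => j _; rewrite !mxE.
  rewrite enorm_eqP enormB_sqr; split=> h; lra.
split=> [h|h i].
  by apply/rowP => i; rewrite [RHS]mxE [X in _ = _ * X]mxE; apply/E; exact: h.
have [j ->|-> //] := unliftP ord0 i; apply/E.
by rewrite h [LHS]mxE [X in _ * X = _]mxE.
Qed.

(** The difference of two such points is a combination of the edges and, by linearity of the system,
    orthogonal to each of them; so it is orthogonal to itself. *)
Lemma circumcenter_uniq y c c' :
  (aff_hull y c /\ forall i, enorm (c - y i) = enorm (c - y ord0)) ->
  (aff_hull y c' /\ forall i, enorm (c' - y i) = enorm (c' - y ord0)) -> c = c'.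
Proof.
move=> [[l [l1 ->]]]; rewrite affine_combE// => /equidistantP h.
move=> [[l' [l'1 ->]]]; rewrite affine_combE// => /equidistantP h'.
congr (_ + _); apply/eqP; rewrite -subr_eq0; apply/eqP; apply: enorm0_eq0.
apply/eqP; rewrite -sqrf_eq0 sqr_enorm_mx.
set w := _ - _.
rewrite {2}/w -mulmxBl trmx_mul mulmxA.
have -> : w *m (edges y)^T = 0 by rewrite /w mulmxBl h h' subrr.
by rewrite mul0mx mxE.
Qed.

Lemma bary_gram V : row_free V -> bary V *m gram V = 2^-1 *: \row_i gram V i i.
Proof.
by rewrite row_free_gram => GU; rewrite /bary -scalemxAl -mulmxA mulVmx// mulmx1.
Qed.

(** [circumcenter] is an [xget] with default 0, so existence has to be exhibited: [bary] solves the
    linear system, and vertex [ord0] receives the missing weight. *)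
Lemma circumcenterP y : affinely_independent y ->
  aff_hull y (circumcenter y) /\
  forall i, enorm (circumcenter y - y i) = enorm (circumcenter y - y ord0).
Proof.
move=> yfree; rewrite /circumcenter.
set P := [set c | _].
suff Pc : P (y ord0 + bary (edges y) *m edges y) by exact: (xgetPex 0 (ex_intro _ _ Pc)).
split; last first.
  by apply/equidistantP; rewrite -mulmxA -/(gram _) bary_gram.
pose a := bary (edges y).
pose l (i : 'I_k.+1) := if unlift ord0 i is Some j then a 0 j else 1 - \sum_j a 0 j.
have l1 : \sum_i l i = 1.
  rewrite big_ord_recl {1}/l unlift_none.
  under [X in _ + X]eq_bigr do rewrite /l liftK.
  by rewrite subrK.
exists l; split=> //; rewrite affine_combE//; congr (_ + _ *m _).
by apply/rowP => i; rewrite [RHS]mxE /l liftK.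
Qed.

Lemma circumcenterE y : affinely_independent y ->
  circumcenter y = y ord0 + bary (edges y) *m edges y.
Proof.
move=> yfree; have [[l [l1 cE]]] := circumcenterP yfree.
rewrite cE affine_combE// => /equidistantP.
rewrite -mulmxA -/(gram _) -bary_gram// => h.
have GU : gram (edges y) \in unitmx by rewrite -row_free_gram.
by congr (_ + _ *m _); rewrite -[LHS](mulmxK GU) -[RHS](mulmxK GU) h.
Qed.

Lemma open_simplexP y a : affinely_independent y ->
  open_simplex y (y ord0 + a *m edges y) <->
  (forall i, 0 < a 0 i) /\ \sum_i a 0 i < 1.
Proof.
move=> yfree; split.
  move=> [l [l0 [l1 /eqP]]]; rewrite affine_combE// (inj_eq (addrI _)) => /eqP h.
  have -> : a = \row_i l (lift ord0 i) by exact: (row_free_inj yfree).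
  split=> [i|]; first by rewrite mxE.
  by rewrite -l1 big_ord_recl; under eq_bigr do rewrite mxE; rewrite ltrDr.
move=> [a0 a1].
pose l (i : 'I_k.+1) := if unlift ord0 i is Some j then a 0 j else 1 - \sum_j a 0 j.
have l1 : \sum_i l i = 1.
  rewrite big_ord_recl {1}/l unlift_none.
  under [X in _ + X]eq_bigr do rewrite /l liftK.
  by rewrite subrK.
exists l; split; first by move=> i; rewrite /l; case: unliftP => //; rewrite subr_gt0.
split=> //; rewrite affine_combE//; congr (_ + _ *m _).
by apply/rowP => i; rewrite [RHS]mxE /l liftK.
Qed.

(** The condition in [h_1], with radius bound [r], in terms of the edge vectors alone: this makes it
    translation invariant. The last norm is the circumradius. *)
Definition good (r : R) V : Prop :=
  [/\ row_free V, forall i, 0 < bary V 0 i, \sum_i bary V 0 i < 1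
    & enorm (bary V *m V) <= r].

Lemma goodP r y :
  [/\ affinely_independent y, open_simplex y (circumcenter y) & circumradius y <= r]
  <-> good r (edges y).
Proof.
have cR : affinely_independent y -> circumradius y = enorm (bary (edges y) *m edges y).
  by move=> yfree; rewrite /circumradius circumcenterE// addrC addKr.
split=> [[yfree] | [yfree a0 a1 cr]].
  by rewrite cR// circumcenterE// => /open_simplexP[]// a0 a1 cr; split.
by split=> //; rewrite ?cR// circumcenterE//; apply/open_simplexP.
Qed.

Lemma gramZ r V : gram (r *: V) = r ^+ 2 *: gram V.
Proof. by rewrite /gram linearZ/= -scalemxAl -scalemxAr scalerA expr2. Qed.

Lemma row_freeZ r V : r != 0 -> row_free (r *: V) = row_free V.
Proof. by move=> r0; rewrite /row_free; have := eqmx_scale V r0; move=> ->. Qed.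

Lemma baryZ r V : 0 < r -> row_free V -> bary (r *: V) = bary V.
Proof.
move=> r0; rewrite row_free_gram => GU.
have r20 : r ^+ 2 != 0 by rewrite expf_neq0// gt_eqF.
rewrite /bary gramZ invmxZ; last by rewrite unitmxZ// unitfE.
rewrite (_ : \row_i _ = r ^+ 2 *: \row_i gram V i i); last by apply/rowP => i; rewrite !mxE.
by rewrite -scalemxAl -scalemxAr !scalerA; congr (_ *: _); field; rewrite gt_eqF.
Qed.

(** [bary] is homogeneous of degree 0 in the edges, because the factors [r ^+ 2] of the Gram matrix
    cancel, and the circumradius has degree 1. *)
Lemma good_scale r V : 0 < r -> good r (r *: V) <-> good 1 V.
Proof.
move=> r0; have rn0 : r != 0 by rewrite gt_eqF.
have E : row_free V -> enorm (bary V *m (r *: V)) = r * enorm (bary V *m V).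
  by move=> _; rewrite -scalemxAr enorm_scale// ltW.
split=> -[].
  rewrite row_freeZ// => Vf; rewrite baryZ// E// => a0 a1; rewrite ger_pMr// => cr.

by move=> Vf a0 a1 cr; split; rewrite ?row_freeZ ?baryZ// E// ger_pMr.
Qed.

(** Both endpoints of an edge are at distance at most [r] from the circumcenter. Consequently the
    set behind [h_1] is bounded and has finite measure. *)
Lemma good_bound r V i j : good r V -> `|V i j| <= 2 * r.
Proof.
move=> [Vf _ _ cr].
(* Any matrix is the edge matrix of the simplex with first vertex 0, to which equidistance
   applies. *)
pose y (l : 'I_k.+1) := if unlift ord0 l is Some i then row i V else 0.
have yV : edges y = V.
  by apply/row_matrixP => l; rewrite rowK /y liftK unlift_none subr0.
have := (equidistantP y (bary V *m V)).2; rewrite yV -mulmxA -/(gram _) bary_gram//.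
move=> /(_ erefl (lift ord0 i)); rewrite /y liftK unlift_none add0r subr0 => Ei.
have -> : V i j = (bary V *m V) 0 j - (bary V *m V - row i V) 0 j.
  by rewrite ![in RHS]mxE; ring.
apply: (le_trans (ler_normB _ _)).
have := entry_le_enorm (bary V *m V) j.
have := entry_le_enorm (bary V *m V - row i V) j.
rewrite Ei => h1 h2; lra.
Qed.

End Circumcenter.

(** * Measurability of the geometric condition *)

Section MeasurableGood.
Variables (R : realType) (k d : nat).
Implicit Types (V : mxspace R k d).

Lemma measurable_det m d' (T : measurableType d') (A : T -> 'M[R]_m) :
  (forall i j, measurable_fun setT (fun x => A x i j)) ->
  measurable_fun setT (fun x => \det (A x)).
Proof.
move=> mA; apply: measurable_sum => s; apply: measurable_funM => //.
by apply: measurable_prod => i _; exact: mA.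
Qed.

Lemma measurable_good r : measurable (@good R k d r : set (mxspace R k d)).
Proof.
pose G (V : mxspace R k d) := gram V.
have mG i j : measurable_fun setT (fun V => G V i j).
  rewrite (_ : (fun V => _) = (fun V : mxspace R k d => \sum_l (V : 'M[R]_(k, d)) i l * (V : 'M[R]_(k, d)) j l)).
    by apply: measurable_sum => l; apply: measurable_funM; exact: measurable_entry.
  by apply/funext => V; rewrite mxE; apply: eq_bigr => l _; rewrite mxE.
pose D V := \det (G V); have mD : measurable_fun setT D by exact: measurable_det.
have madj i j : measurable_fun setT (fun V => (\adj (G V)) i j).
  rewrite (_ : (fun V => _) = (fun V => (-1) ^+ (j + i) * \det (row' j (col' i (G V))))).
    apply: measurable_funM => //; apply: measurable_det => i' j'.
    have := mG (lift j i') (lift i j'); congr (measurable_fun _ _).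
    by apply/funext => V; rewrite [RHS]mxE [RHS]mxE.
  by apply/funext => V; rewrite mxE.
(* By Cramer's rule [a V = numerators / (2 det)], and the sign conditions are cleared
   of denominators. *)
pose N V := (\row_i G V i i) *m \adj (G V).
have mN i : measurable_fun setT (fun V => N V 0 i).
  rewrite (_ : (fun V => _) = (fun V => \sum_l G V l l * (\adj (G V)) l i)).
    by apply: measurable_sum => l; apply: measurable_funM.
  by apply/funext => V; rewrite mxE; apply: eq_bigr => l _; rewrite mxE.
pose Q V := \sum_j (\sum_i N V 0 i * (V : 'M[R]_(k, d)) i j) ^+ 2.
have mQ : measurable_fun setT Q.
  apply: measurable_sum => j; apply: measurable_funX; apply: measurable_sum => i.
  by apply: measurable_funM => //; exact: measurable_entry.
have NE (V : mxspace R k d) : D V != 0 -> bary V = (2 * D V)^-1 *: N V.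
  move=> DV; rewrite /bary /invmx unitmxE unitfE -/(D V) DV.
  by rewrite -scalemxAr scalerA invfM.
(* The radius condition is squared below, which requires [0 <= r]; for negative [r] the set is
   empty. *)
have [r0|r0] := ltP r 0.
  rewrite (_ : @good R k d r = set0) ?measurable0//; apply/seteqP; split=> // V [_ _ _].
  by move=> /(le_trans (enorm_ge0 _)); rewrite leNgt r0.
rewrite (_ : @good R k d r = [set V | D V != 0] `&` ((\bigcap_(i in [set: 'I_k]) [set V | 0 < D V * N V 0 i])
    `&` ([set V | D V * \sum_i N V 0 i < 2 * D V ^+ 2] `&` [set V | Q V <= r ^+ 2 * (2 * D V) ^+ 2]))).
  have mset (b : mxspace R k d -> bool) : measurable_fun setT b -> measurable [set V | b V].
    by move=> mb; rewrite -[X in measurable X]setTI; exact: (mb measurableT [set true]).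
  apply: measurableI.
    rewrite (_ : [set V | _] = ~` (D @^-1` [set 0])).
      by apply: measurableC; rewrite -[X in measurable X]setTI; exact: mD.
    by apply/seteqP; split=> V /= /eqP.
  apply: measurableI.
    apply: fin_bigcap_measurable => [|i _]; first exact: finite_finset.
    by apply: mset; apply: measurable_fun_ltr => //; exact: measurable_funM.
  apply: measurableI; apply: mset.
    apply: measurable_fun_ltr; apply: measurable_funM => //.
    - exact: measurable_sum.
    - exact: measurable_funX.
  apply: measurable_fun_ler => //; apply: measurable_funM => //.
  by apply: measurable_funX; exact: measurable_funM.
have P1 V (i : 'I_k) : D V != 0 -> (0 < bary V 0 i) = (0 < D V * N V 0 i).
  move=> DV; rewrite NE// mxE -[LHS](pmulr_rgt0 _ (_ : 0 < 2 * D V ^+ 2)).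
    by congr (_ < _); field.
  by rewrite mulr_gt0// exprn_even_gt0.
have P2 V : D V != 0 -> (\sum_i bary V 0 i < 1) = (D V * \sum_i N V 0 i < 2 * D V ^+ 2).
  move=> DV; have D0 : 0 < 2 * D V ^+ 2 by rewrite mulr_gt0// exprn_even_gt0.
  rewrite -(ltr_pM2l D0) mulr1; congr (_ < _).
  under eq_bigr do rewrite NE// mxE.
  by rewrite -mulr_sumr; field.
have P3 (V : mxspace R k d) : D V != 0 -> (enorm (bary V *m V) <= r) = (Q V <= r ^+ 2 * (2 * D V) ^+ 2).
  move=> DV; have D0 : 0 < (2 * D V) ^+ 2 by rewrite exprn_even_gt0//= mulf_neq0.
  rewrite -(@ler_pXn2r R 2) ?nnegrE ?enorm_ge0// -(ler_pM2r D0); congr (_ <= _).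
  rewrite sqr_enorm mulr_suml; apply: eq_bigr => j _.
  rewrite -exprMn NE// mxE; congr (_ ^+ 2); rewrite mulr_suml.
  by apply: eq_bigr => i _; rewrite mxE; field.
have DE (V : mxspace R k d) : row_free V = (D V != 0).
  by rewrite row_free_gram unitmxE unitfE.
apply/seteqP; split=> V /=.
  move=> [+ a0 a1 cr]; rewrite DE => DV; split=> //; split.
    by move=> i _ /=; rewrite -P1.
  by rewrite -P2// -P3.
move=> [DV [a0 [a1 cr]]]; split; rewrite ?DE ?P2 ?P3// => i.
by rewrite P1//; exact: a0.
Qed.

End MeasurableGood.

(** * The small-scale limit of the main term *)

(** Telescoping: one factor is exchanged at a time while the others are bounded by [B]. Since
    [1 <= B], the power [B ^+ size s] also dominates shorter products. *)
Lemma prodr_dist_le (R : realDomainType) (I : Type) (s : seq I) (a b : I -> R) (B : R) :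
  1 <= B -> (forall i, 0 <= a i <= B) -> (forall i, 0 <= b i <= B) ->
  `|\prod_(i <- s) a i - \prod_(i <- s) b i| <= B ^+ size s * \sum_(i <- s) `|a i - b i|.
Proof.
move=> B1 aB bB; have B0 : 0 <= B by exact: le_trans B1.
elim: s => [|i s IH]; first by rewrite !big_nil subrr normr0 mulr0.
rewrite !big_cons /= exprS mulrDr.
have -> : a i * \prod_(j <- s) a j - b i * \prod_(j <- s) b j =
   (a i - b i) * \prod_(j <- s) a j + b i * (\prod_(j <- s) a j - \prod_(j <- s) b j) by ring.
apply: (le_trans (ler_normD _ _)); apply: lerD; rewrite normrM.
  rewrite mulrC ler_wpM2r// ger0_norm; last by rewrite prodr_ge0// => j _; case/andP: (aB j).
  apply: (@le_trans _ _ (B ^+ size s)); last by rewrite ler_peMl// exprn_ge0.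
  elim: (s) => [|j t IHt]; first by rewrite big_nil.
  rewrite big_cons exprS ler_pM//; case/andP: (aB j) => //.
  by move=> *; rewrite prodr_ge0// => l _; case/andP: (aB l).
case/andP: (bB i) => bi0 biB; rewrite (ger0_norm bi0) -mulrA.
by rewrite ler_pM.
Qed.

Section GoodTuples.
Variables (R : realType) (k d : nat).
Local Notation E m := (mxspace R m d).

Definition rows m (Y : E m) : 'I_m -> 'rV[R]_d := fun i => row i (Y : 'M[R]_(m, d)).

Definition good_tuples (r : R) : set (E k.+1) := [set Y | good r (edges (rows Y))].

Definition rep (x : 'rV[R]_d) : 'M[R]_(k, d) := \matrix_(i, j) x 0 j.

Lemma edges_col (x : 'rV[R]_d) (Z : 'M[R]_(k, d)) :
  edges (rows (col_mx x (rep x + Z) : E k.+1)) = Z.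
Proof.
apply/matrixP => i j; rewrite !mxE.
rewrite (_ : lift ord0 i = rshift 1 i); last exact/ord_inj.
rewrite (_ : ord0 = lshift k (0 : 'I_1)); last exact/ord_inj.
rewrite (unsplitK (inr i)) (unsplitK (inl 0)) !mxE; ring.
Qed.

Lemma measurable_good_tuples r : measurable (good_tuples r).
Proof.
have m_edges : measurable_fun setT (fun Y : E k.+1 => edges (rows Y) : E k).
  apply: measurable_to_mxspace => i j.
  rewrite (_ : (fun Y => _) = (fun Y : E k.+1 =>
     (Y : 'M[R]_(k.+1, d)) (lift ord0 i) j - (Y : 'M[R]_(k.+1, d)) ord0 j)).
    by apply: measurable_funB; exact: measurable_entry.
  by apply/funext => Y; rewrite !mxE.
rewrite -[X in measurable X]setTI.
exact: (m_edges measurableT _ (@measurable_good R k d r)).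
Qed.

Lemma h1E (Z : E k) : h1 (Z : 'M[R]_(k, d)) = \1_(@good R k d 1 : set (E k)) Z.
Proof.
have edgesZ : edges (pts0 (Z : 'M[R]_(k, d))) = Z.
  apply/matrixP => i j; rewrite mxE /pts0 liftK unlift_none subr0 mxE //.
rewrite /h1 indicE; case: asboolP => [/goodP|h].
  by rewrite edgesZ => gZ; rewrite mem_set.
by rewrite memNset// => gZ; apply: h; apply/goodP; rewrite edgesZ.
Qed.

End GoodTuples.
Arguments good_tuples {R k d}.

Section SmallScaleLimit.
Variables (R : realType) (k d : nat).
Local Notation E m := (mxspace R m d).
Variables (lam : {measure set (E 1) -> \bar R}) (hlam : is_lebesgue lam).
Variables (lamk : {measure set (E k) -> \bar R}) (hlamk : is_lebesgue lamk).
Variables (L : {measure set (E k.+1) -> \bar R}) (hL : is_lebesgue L).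
Variables (f : E 1 -> R) (mf : measurable_fun setT f) (f0 : forall x, 0 <= f x).
Hypothesis f1 : (\int[lam]_x (f x)%:E = 1)%E.
Variables (B : R) (B1 : 1 <= B) (fB : forall x, f x <= B).

Let B0 : 0 <= B. Proof. exact: le_trans B1. Qed.
Let fB0 x : 0 <= f x <= B. Proof. by rewrite f0 fB. Qed.

Definition shifted (r : R) (p : E 1 * E k) : R :=
  f p.1 * \prod_i f (r *: rows p.2 i + (p.1 : 'rV[R]_d)).

Lemma measurable_shifted r : measurable_fun setT (shifted r).
Proof.
apply: measurable_funM; first exact: measurableT_comp mf measurable_fst.
apply: measurable_prod => i _.
have mg : measurable_fun setT (fun p : E 1 * E k => (r *: rows p.2 i + (p.1 : 'rV[R]_d) : E 1)).
  apply: measurable_to_mxspace => i' j; under eq_fun do rewrite !mxE.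
  apply: measurable_funD; last exact: measurableT_comp (measurable_entry _ _) measurable_fst.
  by apply: measurable_funM => //; exact: measurableT_comp (measurable_entry _ _) measurable_snd.
exact: measurableT_comp mf mg.
Qed.

Lemma shifted_ge0 r p : 0 <= shifted r p.
Proof. by rewrite mulr_ge0// prodr_ge0. Qed.

(** The integral over the base point for a fixed shape [Z]; scale [r = 0] gives the limiting
    value. *)
Definition overlap (r : R) (Z : E k) : \bar R := (\int[lam]_x (shifted r (x, Z))%:E)%E.

Lemma overlap_ge0 r Z : (0 <= overlap r Z)%E.
Proof. by apply: integral_ge0 => x _; rewrite lee_fin shifted_ge0. Qed.

Let mshiftedx r Z : measurable_fun setT (fun x => (shifted r (x, Z))%:E).
Proof.
by apply/measurable_EFinP; exact: measurableT_comp (measurable_shifted r) (pair2_measurable Z).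
Qed.

Lemma overlap_le r Z : (overlap r Z <= (B ^+ k)%:E)%E.
Proof.
rewrite -[X in (_ <= X)%E]mule1 -f1 -ge0_integralZl_EFin//; last 3 first.
- by move=> x _; rewrite lee_fin.
- exact/measurable_EFinP.
- exact: exprn_ge0.
apply: ge0_le_integral => //.
- by move=> x _; rewrite lee_fin shifted_ge0.
- by apply/measurable_EFinP; exact: measurable_funM.
move=> x _; rewrite -EFinM lee_fin /shifted/= mulrC ler_wpM2r//.
rewrite -[X in B ^+ X]card_ord -prodr_const.
by apply: ler_prod => i _; exact: fB0.
Qed.

Lemma measurable_overlap r : measurable_fun setT (overlap r).
Proof.
apply: (@measurable_fun_fubini_tonelli_G _ _ (E 1) (E k) R (sflebesgue hlam)
  (fun p => (shifted r p)%:E)).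
  by apply/measurable_EFinP; exact: measurable_shifted.
by move=> p; rewrite lee_fin shifted_ge0.
Qed.

(** For a fixed first point the remaining rows are substituted by [x + r Z]. The edge matrix becomes
    [r *: Z], so the condition at radius [r] becomes the one at radius 1, and Tonelli brings the
    integral over [x] inside. *)
Lemma good_tuples_scaled r : 0 < r ->
  (\int[L]_(Y in good_tuples r) (pdens f Y)%:E
     = (r ^+ (k * d))%:E * \int[lamk]_(Z in @good R k d 1) overlap r Z)%E.
Proof.
move=> r0; rewrite integral_in_indic.
have mH : measurable (good_tuples r : set (E k.+1)) := measurable_good_tuples r.
have mG : measurable (@good R k d 1 : set (E k)) := @measurable_good R k d 1.
have mF : measurable_fun setT (fun Y : E k.+1 => (pdens f Y * \1_(good_tuples r) Y)%:E).
  apply/measurable_EFinP; apply: measurable_funM; first exact: measurable_pdens.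
  exact: measurable_indic.
have F0 (Y : E k.+1) : (0 <= (pdens f Y * \1_(good_tuples r) Y)%:E)%E.
  by rewrite lee_fin mulr_ge0// pdens_ge0.
rewrite (@lebesgue_tonelli R 1 k d _ hlam _ hlamk L hL)//.
have mFx (x : E 1) : measurable_fun setT (fun Y : E k =>
    (pdens f (col_mx x Y : E (1 + k)) * \1_(good_tuples r) (col_mx x Y : E (1 + k)))%:E).
  have mcx : measurable_fun setT (fun Y : E k => col_mx x Y : E (1 + k)).
    exact: measurableT_comp (@measurable_col_mx R 1 k d) (pair1_measurable x).
  exact: (measurableT_comp mF mcx).
have E1 (x : E 1) (Z : E k) :
    pdens f (col_mx x (rep k x + r *: (Z : 'M[R]_(k, d))) : E (1 + k)) *
    \1_(good_tuples r) (col_mx x (rep k x + r *: (Z : 'M[R]_(k, d))) : E (1 + k))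
    = shifted r (x, Z) * \1_(@good R k d 1 : set (E k)) Z.
  congr (_ * _).
    rewrite pdens_col /shifted/=; congr (_ * _).
    apply: eq_bigr => i _; congr f; apply/rowP => j; rewrite !mxE; exact: addrC.
  have gE := good_scale (Z : 'M[R]_(k, d)) r0.
  rewrite !indicE; congr (nat_of_bool _)%:R; apply/idP/idP; rewrite !inE /good_tuples /=.
    by move=> h; apply/gE; move: h; rewrite edges_col.
  by move=> /gE; rewrite edges_col.
under eq_integral => x _.
  rewrite -(lebesgue_affine (rep k x) hlamk r0 (mFx x)); last by move=> Y; exact: F0.
  under eq_integral do rewrite E1.
  over.
pose G := fun p : E 1 * E k => (shifted r p * \1_(@good R k d 1 : set (E k)) p.2)%:E.
have mGG : measurable_fun setT G.
  apply/measurable_EFinP; apply: measurable_funM; first exact: measurable_shifted.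
  have m1 : measurable_fun setT (\1_(@good R k d 1 : set (E k)) : E k -> R) by exact: measurable_indic.
  exact: measurableT_comp m1 measurable_snd.
have G0 p : (0 <= G p)%E by rewrite lee_fin mulr_ge0// shifted_ge0.
rewrite ge0_integralZl_EFin//; last 3 first.
- by move=> x _; apply: integral_ge0 => Z _; exact: (G0 (x, Z)).
- exact: (@measurable_fun_fubini_tonelli_F _ _ (E 1) (E k) R (sflebesgue hlamk) G).
- exact/exprn_ge0/ltW.
congr (_ * _)%E; rewrite (lebesgue_tonelli_swap hlam hlamk mGG G0).
rewrite [RHS]integral_mkcond epatch_indic; apply: eq_integral => Z _.
rewrite /G/= muleC -ge0_integralZl_EFin//; last by move=> x _; rewrite lee_fin shifted_ge0.
by apply: eq_integral => x _; rewrite mulrC EFinM.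
Qed.

Lemma integrable_density : lam.-integrable setT (EFin \o f).
Proof.
apply/integrableP; split; first exact/measurable_EFinP.
under eq_integral do rewrite /= ger0_norm//.
by rewrite f1 ltry.
Qed.

(** Telescoping costs [B ^+ k] and the outer factor [f x] one more [B]. Two additive inequalities
    replace an absolute value of extended reals. *)
Lemma overlap_diff r (Z : E k) :
  (overlap r Z <= overlap 0 Z + (B ^+ k.+1)%:E * \sum_i modulus lam f (r *: rows Z i))%E /\
  (overlap 0 Z <= overlap r Z + (B ^+ k.+1)%:E * \sum_i modulus lam f (r *: rows Z i))%E.
Proof.
pose S x := \sum_i `|f (r *: rows Z i + (x : 'rV[R]_d)) - f x|.
have mS : measurable_fun setT (fun x : E 1 => (S x)%:E).
  apply/measurable_EFinP; apply: measurable_sum => i; apply: measurableT_comp => //.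
  by apply: measurable_funB => //; exact: measurable_shift.
have S0 x : 0 <= S x by apply: sumr_ge0.
have BK0 : 0 <= B ^+ k.+1 by exact: exprn_ge0.
have -> : ((B ^+ k.+1)%:E * \sum_i modulus lam f (r *: rows Z i)
   = \int[lam]_x ((B ^+ k.+1) * S x)%:E)%E.
  under [RHS]eq_integral do rewrite EFinM.
  rewrite ge0_integralZl_EFin//; last by move=> x _; rewrite lee_fin.
  congr (_ * _)%E.
  rewrite -ge0_integral_sum//; last first.
    move=> i; apply/measurable_EFinP; apply: measurableT_comp => //.
    by apply: measurable_funB => //; exact: measurable_shift.
  by apply: eq_integral => x _; rewrite sumEFin.
have mBS : measurable_fun setT (fun x : E 1 => (B ^+ k.+1 * S x)%:E).
  by apply/measurable_EFinP; apply: measurable_funM => //; apply/measurable_EFinP.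
have diff x : `|shifted r (x, Z) - shifted 0 (x, Z)| <= B ^+ k.+1 * S x.
  rewrite /shifted/= -mulrBr normrM ger0_norm// exprS -mulrA.
  apply: ler_pM => //.
  under [X in _ - X]eq_bigr do rewrite scale0r add0r.
  have := @prodr_dist_le R _ (index_enum 'I_k) (fun i => f (r *: rows Z i + (x : 'rV[R]_d)))
    (fun=> f x) B B1 (fun i => fB0 _) (fun i => fB0 _).
  by rewrite [size _](_ : _ = k)// /index_enum -enumT size_enum_ord.
split; rewrite -ge0_integralD//.
all: try by move=> x _; rewrite lee_fin ?shifted_ge0// mulr_ge0.
all: apply: ge0_le_integral => //.
all: try by move=> x _; rewrite lee_fin ?shifted_ge0// mulr_ge0.
all: try exact: emeasurable_funD.
all: move=> x _; rewrite -EFinD lee_fin; have := diff x; rewrite ler_norml; lra.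
Qed.

Variables (r : nat -> R) (r0 : forall n, 0 < r n) (rcvg : r @ \oo --> 0).

Lemma cvg_overlap (Z : E k) :
  (fun n => overlap (r n) Z) @ \oo --> overlap 0 Z.
Proof.
have fin s : overlap s Z \is a fin_num.
  by rewrite ge0_fin_numE ?overlap_ge0// (le_lt_trans (overlap_le _ _))// ltry.
rewrite -(fineK (fin 0)); apply/fine_cvgP; split; first exact: nearW.
apply/cvgrPdist_le => e e0.
have BK0 : 0 < B ^+ k.+1 by rewrite exprn_gt0// (lt_le_trans ltr01).
(* Dividing by [k.+1] instead of [k] avoids a zero denominator; the [k] moduli then add up to at
   most [e]. *)
pose e' := e / (B ^+ k.+1 * k.+1%:R).
have e'0 : 0 < e' by rewrite divr_gt0// mulr_gt0.
have hcont i : \forall n \near \oo, (modulus lam f (r n *: rows Z i) <= e'%:E)%E.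
  have hh i' j : (fun n => (r n *: rows Z i) i' j) @ \oo --> 0.
    under eq_fun do rewrite mxE.
    by rewrite -(mul0r (rows Z i i' j)); apply: cvgMl.
  exact: (l1_continuous_integrable hlam hh integrable_density).2.
have hall : \forall n \near \oo, forall i, (modulus lam f (r n *: rows Z i) <= e'%:E)%E.
  by apply: filter_forall.
near=> n.
have hn : forall i, (modulus lam f (r n *: rows Z i) <= e'%:E)%E by near: n.
have [] := overlap_diff (r n) Z.
have sum_le : ((B ^+ k.+1)%:E * \sum_i modulus lam f (r n *: rows Z i) <= e%:E)%E.
  apply: (@le_trans _ _ ((B ^+ k.+1)%:E * \sum_(i < k) e'%:E)%E).
    by apply: lee_wpmul2l; [rewrite lee_fin ltW|apply: lee_sum].
  rewrite sumEFin -EFinM lee_fin sumr_const card_ord -mulr_natr /e'.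
  have -> : B ^+ k.+1 * (e / (B ^+ k.+1 * k.+1%:R) * k%:R) = e * (k%:R / k.+1%:R).
    by field; apply/andP; split; rewrite gt_eqF// -[1]/(1%:R) -natrD ltr0n addn1.
  by rewrite ger_pMr// ler_pdivrMr// mul1r ler_nat.
move=> /le_trans /(_ (leeD2l _ sum_le)) h1 /le_trans /(_ (leeD2l _ sum_le)) h2.
rewrite /=; move: h1 h2; move: (fin (r n)) (fin 0).
case: (overlap (r n) Z) => // a _; case: (overlap 0 Z) => // b _.
by rewrite -!EFinD !lee_fin /= ler_norml => h1 h2; apply/andP; split; lra.
Unshelve. all: by end_near. Qed.

Lemma overlap0 Z : overlap 0 Z = (\int[lam]_x (f x ^+ k.+1)%:E)%E.
Proof.
apply: eq_integral => x _; rewrite /shifted/= exprS; congr (_ * _)%:E.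
under eq_bigr do rewrite scale0r add0r.
by rewrite prodr_const card_ord.
Qed.

(** Dominated convergence in the shape [Z]: the overlaps are at most [B ^+ k], since [f] has mass 1,
    and the shapes fill a subset of a cube. *)
Lemma good_tuples_limit :
  (fun n => ((r n ^+ (d * k))^-1)%:E * \int[L]_(Y in good_tuples (r n)) (pdens f Y)%:E)%E
    @ \oo --> ((\int[lam]_x (f x ^+ k.+1)%:E) * (\int[lamk]_Z (h1 (Z : 'M[R]_(k, d)))%:E))%E.
Proof.
have mG : measurable (@good R k d 1 : set (E k)) := @measurable_good R k d 1.
under eq_cvg => n.
  rewrite good_tuples_scaled// muleA -EFinM mulnC mulVf ?mul1e; last first.
    by rewrite expf_neq0// gt_eqF.
  over.
pose J := (\int[lam]_x (f x ^+ k.+1)%:E)%E.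
have -> : (J * \int[lamk]_Z (h1 (Z : 'M[R]_(k, d)))%:E
    = \int[lamk]_(Z in @good R k d 1) overlap 0 Z)%E.
  under [RHS]eq_integral do rewrite overlap0.
  rewrite integral_cst//; congr (_ * _)%E.
  under eq_integral do rewrite h1E.
  by rewrite integral_indic// setIT.
have bd : (@good R k d 1 : set (E k)) `<=` @cube R k d 2.
  by move=> Z gZ; apply/in_cube => i j; rewrite (le_trans (good_bound i j gZ))// mulr1.
have [] := @dominated_convergence _ _ _ lamk (@good R k d 1) mG
  (fun n => overlap (r n)) (overlap 0) (cst (B ^+ k)%:E).
- by move=> n; apply: measurable_funTS; exact: measurable_overlap.
- by apply: measurable_funTS; exact: measurable_overlap.
- by apply: aeW => Z _; exact: cvg_overlap.
- apply/integrableP; split => //.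
  under eq_integral do rewrite /= ger0_norm ?exprn_ge0//.
  rewrite integral_cst// lte_mul_pinfty ?lee_fin ?exprn_ge0//.
  by apply: le_lt_trans (lebesgue_cube 2 hlamk); apply: le_measure => //;
    rewrite inE//; exact: measurable_cube.
- by apply: aeW => Z n _; rewrite gee0_abs ?overlap_ge0// overlap_le.
by [].
Qed.

End SmallScaleLimit.

(** * Tuples with an intruder *)

Section Crowded.
Variables (R : realType) (k d : nat).
Local Notation E m := (mxspace R m d).

(** Row 0 is the intruder, the other rows form the good tuple. Lying in the closed circumball is
    relaxed to a coordinatewise bound [2 * r] against the first vertex, through the center; given
    the tuple, this is a box. *)
Definition crowded (r : R) : set (E (1 + k.+1)) :=
  [set W | good_tuples r (dsubmx (W : 'M[R]_(1 + k.+1, d)) : E k.+1) /\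
     forall j, `|usubmx (W : 'M[R]_(1 + k.+1, d)) 0 j
                 - dsubmx (W : 'M[R]_(1 + k.+1, d)) 0 j| <= 2 * r].

Lemma measurable_crowded r : measurable (crowded r).
Proof.
apply: measurableI.
  rewrite -[X in measurable X]setTI.
  exact: (@measurable_dsubmx R 1 k.+1 d) measurableT _ (measurable_good_tuples r).
rewrite [X in measurable X](_ : _ = \bigcap_(j in [set: 'I_d])
   [set W : E (1 + k.+1) | `|usubmx (W : 'M[R]_(1 + k.+1, d)) 0 j
                 - dsubmx (W : 'M[R]_(1 + k.+1, d)) 0 j| <= 2 * r]); last first.
  by apply/seteqP; split => W /= h j; [move=> _|]; exact: h.
apply: fin_bigcap_measurable => [|j _]; first exact: finite_finset.
have mb : measurable_fun setT (fun W : E (1 + k.+1) => `|usubmx (W : 'M[R]_(1 + k.+1, d)) 0 j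
                 - dsubmx (W : 'M[R]_(1 + k.+1, d)) 0 j| <= 2 * r).
  apply: measurable_fun_ler => //; apply: measurableT_comp => //; apply: measurable_funB.
    exact: measurableT_comp (measurable_entry 0 j) (@measurable_usubmx R 1 k.+1 d).
  exact: measurableT_comp (measurable_entry 0 j) (@measurable_dsubmx R 1 k.+1 d).
by rewrite -[X in measurable X]setTI; exact: (mb measurableT [set true]).
Qed.

Variables (lam : {measure set (E 1) -> \bar R}) (hlam : is_lebesgue lam).
Variables (L : {measure set (E k.+1) -> \bar R}) (hL : is_lebesgue L).
Variables (L2 : {measure set (E (1 + k.+1)) -> \bar R}) (hL2 : is_lebesgue L2).
Variables (f : E 1 -> R) (mf : measurable_fun setT f) (f0 : forall x, 0 <= f x).
Variables (B : R) (B0 : 0 <= B) (fB : forall x, f x <= B).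

(** Integrating the intruder first, with the tuple fixed, gives at most [B] times the volume of its
    cube. *)
Lemma crowded_le r : 0 <= r ->
  (\int[L2]_(W in crowded r) (pdens f W)%:E
   <= (B * (4 * r) ^+ d)%:E * \int[L]_(Y in good_tuples r) (pdens f Y)%:E)%E.
Proof.
move=> r0; rewrite integral_in_indic [X in (_ <= _ * X)%E]integral_in_indic.
have mH : measurable (good_tuples r : set (E k.+1)) := measurable_good_tuples r.
have mC : measurable (crowded r) := measurable_crowded r.
pose F (W : E (1 + k.+1)) := (pdens f W * \1_(crowded r) W)%:E.
have mF : measurable_fun setT F.
  by apply/measurable_EFinP; apply: measurable_funM;
    [exact: measurable_pdens|exact: measurable_indic].
have F0 W : (0 <= F W)%E by rewrite lee_fin mulr_ge0// pdens_ge0.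
have mFc : measurable_fun setT (fun p : E 1 * E k.+1 => F (col_mx p.1 p.2)).
  exact: measurableT_comp mF (@measurable_col_mx R 1 k.+1 d).
rewrite (lebesgue_tonelli hlam hL hL2 mF F0).
rewrite (lebesgue_tonelli_swap hlam hL mFc (fun p => F0 _)).
have mG : measurable_fun setT (fun Y : E k.+1 => (pdens f Y * \1_(good_tuples r) Y)%:E).
  by apply/measurable_EFinP; apply: measurable_funM;
    [exact: measurable_pdens|exact: measurable_indic].
have G0 (Y : E k.+1) : (0 <= (pdens f Y * \1_(good_tuples r) Y)%:E)%E.
  by rewrite lee_fin mulr_ge0// pdens_ge0.
have C0 : 0 <= B * (4 * r) ^+ d by rewrite mulr_ge0// exprn_ge0// mulr_ge0.
rewrite -ge0_integralZl_EFin//.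
apply: ge0_le_integral => //.
- by move=> Y _; apply: integral_ge0 => x _.
- exact: (@measurable_fun_fubini_tonelli_G _ _ (E 1) (E k.+1) R (sflebesgue hlam)
    (fun p => F (col_mx p.1 p.2)) mFc (fun p => F0 _)).
- exact: emeasurable_funM.
move=> Y _.
pose Q : set (E 1) := mxbox (\row_j ((Y : 'M[R]_(k.+1, d)) 0 j - 2 * r))
                            (\row_j ((Y : 'M[R]_(k.+1, d)) 0 j + 2 * r)).
have mQ : measurable Q by exact: measurable_mxbox.
have LQ : lam Q = ((4 * r) ^+ d)%:E.
  rewrite hlam; last by move=> i j; rewrite !mxE lerD2l ge0_cp// mulr_ge0.
  rewrite big_ord1 -[X in _ ^+ X]card_ord -prodr_const; congr _%:E.
  by apply: eq_bigr => j _; rewrite !mxE; ring.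
apply: (@le_trans _ _ (\int[lam]_x ((B * (pdens f Y * \1_(good_tuples r) Y))%:E * (\1_Q x)%:E))%E).
  apply: ge0_le_integral => //.
  - by apply: (measurableT_comp mFc); exact: pair2_measurable.
  - by apply: emeasurable_funM => //; apply/measurable_EFinP; exact: measurable_indic.
  move=> x _; rewrite /F -EFinM lee_fin pdens_col.
  have : \1_(crowded r) (col_mx x Y : E (1 + k.+1)) <= \1_(good_tuples r) Y * \1_Q x :> R.
    rewrite [X in X <= _]indicE; case: (boolP (_ \in _)); last first.
      by rewrite mulr_ge0.
    rewrite inE => -[]; rewrite col_mxKd col_mxKu => gY xY.
    rewrite !indicE !mem_set ?mulr1//= => i j; rewrite !mxE (ord1 i).
    by have := xY j; rewrite ler_norml; lra.
  move=> h; apply: (@le_trans _ _ (f x * pdens f Y * (\1_(good_tuples r) Y * \1_Q x))).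
    by apply: ler_wpM2l => //; rewrite mulr_ge0// pdens_ge0.
  rewrite -!mulrA; apply: ler_wpM2r => //.
  by rewrite !mulr_ge0// pdens_ge0.
rewrite ge0_integralZl_EFin//; last 2 first.
- by apply/measurable_EFinP; exact: measurable_indic.
- by rewrite !mulr_ge0// pdens_ge0.
by rewrite integral_indic// setIT LQ -!EFinM lee_fin; rewrite mulrAC.
Qed.

End Crowded.
Arguments crowded {R k d}.

Lemma pdens_mass (R : realType) m d
    (lam : {measure set (mxspace R 1 d) -> \bar R}) (hlam : is_lebesgue lam)
    (L : {measure set (mxspace R m d) -> \bar R}) (hL : is_lebesgue L)
    (f : mxspace R 1 d -> R) (mf : measurable_fun setT f) (f0 : forall x, 0 <= f x) :
  (\int[lam]_x (f x)%:E = 1)%E -> (\int[L]_Y (pdens f Y)%:E = 1)%E.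
Proof.
move=> f1; rewrite (integral_prod_rows hlam hL (fun=> mf) (fun=> f0)).
by rewrite big1// => i _; exact: mule1.
Qed.

(** * Critical points and tuples of sample points *)

Section TupleCount.
Variables (R : realType) (d : nat).

Definition pt (s : seq 'rV[R]_d) m (t : m.-tuple 'I_(size s)) : mxspace R m d :=
  \matrix_(i < m, j < d) (nth 0 s (tnth t i)) 0 j.

(** [uniq] concerns indices, so equal points at different positions count separately. *)
Definition tupset (s : seq 'rV[R]_d) m (B : set (mxspace R m d)) : {set m.-tuple 'I_(size s)} :=
  [set t : m.-tuple 'I_(size s) | uniq t & `[< B (pt t) >]].

Definition tupcount s m B : nat := #|@tupset s m B|.

Lemma rows_pt s m (t : m.-tuple 'I_(size s)) i : rows (pt t) i = nth 0 s (tnth t i).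
Proof. by apply/rowP => j; rewrite !mxE. Qed.

End TupleCount.

Section Sandwich.
Variables (R : realType) (d k : nat).
Local Notation E m := (mxspace R m d).
Implicit Types (y : 'I_k.+1 -> 'rV[R]_d) (c : 'rV[R]_d).

(** The definition singles out vertex [ord0]; this symmetric form makes invariance under
    permutations immediate. *)
Lemma affinely_independentP y : affinely_independent y <->
  forall l : 'I_k.+1 -> R, \sum_i l i = 0 -> \sum_i l i *: y i = 0 -> forall i, l i = 0.
Proof.
have E (l : 'I_k.+1 -> R) : \sum_i l i = 0 ->
    \sum_i l i *: y i = (\row_i l (lift ord0 i)) *m edges y.
  move=> l0; rewrite mulmx_sum_row.
  under [RHS]eq_bigr do rewrite rowK mxE scalerBr.
  rewrite sumrB -scaler_suml big_ord_recl addrC; congr (_ + _).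
  rewrite -scaleNr; congr (_ *: _); apply/eqP.
  by rewrite -addr_eq0; move: l0; rewrite big_ord_recl => ->.
split=> [yfree l l0|h].
  rewrite E// => ly0.
  have l'0 : \row_i l (lift ord0 i) = 0 by apply: (row_free_inj yfree); rewrite mul0mx.
  have ll i : l (lift ord0 i) = 0 by move/rowP : l'0 => /(_ i); rewrite !mxE.
  move=> i; have [j ->//|->] := unliftP ord0 i.
  by move: l0; rewrite big_ord_recl big1 ?addr0.
rewrite /affinely_independent -/(edges y) -kermx_eq0; apply/eqP/row_matrixP => i; rewrite row0.
set u := row i _.
have uV : u *m edges y = 0 by apply/sub_kermxP; exact: row_sub.
pose l (j : 'I_k.+1) := if unlift ord0 j is Some j' then u 0 j' else - \sum_j u 0 j.
have l0 : \sum_j l j = 0.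
  rewrite big_ord_recl {1}/l unlift_none.
  under [X in _ + X]eq_bigr do rewrite /l liftK.
  by rewrite addNr.
have lu : \row_j l (lift ord0 j) = u by apply/rowP => j; rewrite mxE /l liftK.
have := h l l0; rewrite E// lu => /(_ uV) ll.
by apply/rowP => j; rewrite -lu !mxE ll.
Qed.

Lemma affinely_independent_perm y (p : 'S_k.+1) :
  affinely_independent y -> affinely_independent (y \o p).
Proof.
move=> /affinely_independentP h; apply/affinely_independentP => l l0 ly i.
have /(_ _ _ (p i)) := h (fun j => l ((p^-1)%g j)); rewrite permK; apply.
  by rewrite -[RHS]l0 (reindex_inj (@perm_inj _ p)); apply: eq_bigr => j _; rewrite permK.
by rewrite -[RHS]ly (reindex_inj (@perm_inj _ p)); apply: eq_bigr => j _; rewrite permK.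
Qed.

Lemma affinely_independent_inj y : affinely_independent y -> injective y.
Proof.
move=> /affinely_independentP h i i' yi; apply/eqP/negPn/negP => ii'.
(* If two vertices coincided, the difference of the two unit weights would be a nontrivial affine
   relation. *)
pose l j : R := (j == i)%:R - (j == i')%:R.
have sum_delta i0 : \sum_(j < k.+1) ((j == i0)%:R : R) = 1.
  by rewrite (bigD1 i0)//= eqxx big1 ?addr0// => j /negPf ->.
have sum_deltay i0 : \sum_(j < k.+1) ((j == i0)%:R : R) *: y j = y i0.
  rewrite (bigD1 i0)//= eqxx scale1r big1 ?addr0// => j /negPf ->.
  by rewrite scale0r.
have := h l; rewrite sumrB !sum_delta subrr => /(_ erefl).
under eq_bigr do rewrite scalerBl.
rewrite sumrB !sum_deltay yi subrr => /(_ erefl i).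
by rewrite /l eqxx (negPf ii') subr0 => /eqP; rewrite oner_eq0.
Qed.

Lemma open_simplex_perm y (p : 'S_k.+1) c :
  open_simplex y c -> open_simplex (y \o p) c.
Proof.
move=> [l [l0 [l1 ->]]]; exists (l \o p); split; first by move=> i; exact: l0.
by split; [rewrite -l1 [RHS](reindex_inj (@perm_inj _ p))|rewrite [LHS](reindex_inj (@perm_inj _ p))].
Qed.

Lemma open_simplex_aff_hull y c : open_simplex y c -> aff_hull y c.
Proof. by move=> [l [_ lE]]; exists l. Qed.

Lemma circumcenter_eq y c : affinely_independent y -> open_simplex y c ->
  (forall i, enorm (c - y i) = enorm (c - y ord0)) -> circumcenter y = c.
Proof.
move=> yfree cy ceq; apply: (@circumcenter_uniq _ _ _ y); first exact: circumcenterP.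
by split=> //; exact: open_simplex_aff_hull.
Qed.

Lemma distfunE (S : set 'rV[R]_d) c p :
  S p -> (forall q, S q -> enorm (c - p) <= enorm (c - q)) -> distfun S c = enorm (c - p).
Proof.
move=> Sp h; apply/eqP; rewrite eq_le; apply/andP; split.
  apply: ge_inf; last by exists p.
  by exists 0 => _ [q _ <-]; exact: enorm_ge0.
apply: lb_le_inf; first by exists (enorm (c - p)), p.
by move=> _ [q Sq <-]; exact: h.
Qed.

Variables (s : seq 'rV[R]_d) (r : R).
Local Notation S := [set x | x \in s].
Local Notation tup := (k.+1.-tuple 'I_(size s)).

Definition center (t : tup) : 'rV[R]_d := circumcenter (rows (pt t)).

Definition crit : set 'rV[R]_d := [set c | is_critical S k c /\ distfun S c <= r].

Let U : {set tup} := tupset s (good_tuples r).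

Lemma tupsetP (t : tup) : t \in U <-> uniq t /\
  [/\ affinely_independent (rows (pt t)), open_simplex (rows (pt t)) (center t)
    & circumradius (rows (pt t)) <= r].
Proof.
rewrite inE; split=> [/andP[ut /asboolP gt]|[ut gt]].
  by split=> //; apply/goodP.
by rewrite ut; apply/asboolP/goodP.
Qed.

(** Each ordering of the defining points yields an index tuple, a point being located by its first
    occurrence in [s]. The point [c] is their circumcenter because it is equidistant and in their
    affine hull. *)
Lemma crit_fiber c : crit c -> (k.+1`! <= #|[set t in U | center t == c]|)%N.
Proof.
move=> [[y [yS yfree ceq _ cy]] cr].
have yi i : (index (y i) s < size s)%N by rewrite index_mem; exact: yS.
pose tp (p : 'S_k.+1) : tup := [tuple Ordinal (yi (p i)) | i < k.+1].
have rows_tp p : rows (pt (tp p)) = y \o p.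
  apply/funext => i; rewrite rows_pt tnth_mktuple nth_index//; exact: yS.
have tp_inj : injective tp.
  move=> p q /(congr1 (fun t => tnth t)) pq; apply/permP => i.
  have := congr1 (fun g => val (g i)) pq; rewrite !tnth_mktuple/=.
  move=> /(congr1 (nth 0 s)); rewrite !nth_index; [|exact: yS..].
  exact: affinely_independent_inj.
have tpU p : tp p \in [set t in U | center t == c].
  have pfree := affinely_independent_perm p yfree.
  have cE : center (tp p) = c.
    rewrite /center rows_tp; apply: circumcenter_eq => //; first exact: open_simplex_perm.
    by move=> i /=; rewrite !ceq.
  rewrite inE cE eqxx andbT; apply/tupsetP; split.
    apply/(tuple_uniqP (tp p)) => i j; rewrite !tnth_mktuple => -[].
    move=> /(congr1 (nth 0 s)); rewrite !nth_index; [|exact: yS..].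
    by move=> /(affinely_independent_inj yfree)/perm_inj.
  split; rewrite ?cE rows_tp//; first exact: open_simplex_perm.
  by rewrite /circumradius -rows_tp -/(center _) cE rows_tp ceq.
rewrite -(card_Sn k.+1) -(card_imset _ tp_inj); apply: subset_leq_card.
by apply/fintype.subsetP => _ /imsetP[p _ ->].
Qed.

(** Every critical point has a nonempty fiber, hence is the center of one of finitely many tuples.
    Finiteness lets [counting] be read as a natural number. *)
Lemma finite_crit : finite_set crit.
Proof.
apply: (@sub_finite_set _ _ (center @` [set t | t \in U])).
  move=> c /crit_fiber; have [->|[t]] := set_0Vmem [set t in U | center t == c].
    by rewrite cards0 leqNgt fact_gt0.
  by rewrite inE => /andP[tU /eqP <-] _; exists t.
exact/finite_image/finite_finset.
Qed.

Let L : seq 'rV[R]_d := finmap.enum_fset (fset_set crit).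

Let Luniq : uniq L. Proof. exact: finmap.fset_uniq. Qed.

Let mem_L c : c \in L <-> crit c.
Proof.
split=> [cL|cc].
  by apply/set_mem; rewrite -(in_fset_set finite_crit).
by rewrite (in_fset_set finite_crit c : (c \in L) = _); exact/mem_set.
Qed.

Lemma Ncrit_size : Ncrit S k r = (size L)%:R%:E.
Proof. by rewrite /Ncrit /counting asboolT//; exact: finite_crit. Qed.

Let card_fibers (A : {set tup}) :
  (\sum_(c <- L) #|[set t in A | center t == c]| = \sum_(t in A) (center t \in L))%N.
Proof.
under eq_bigr do rewrite -sum1dep_card big_mkcondr.
rewrite exchange_big/=; apply: eq_bigr => t tA.
rewrite -(count_uniq_mem _ Luniq) -sum1_count [RHS]big_mkcond.
by apply: eq_bigr => c _; rewrite eq_sym.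
Qed.

Lemma Ncrit_le : (k.+1`! * size L <= tupcount s (@good_tuples R k d r))%N.
Proof.
apply: (@leq_trans (\sum_(c <- L) #|[set t in U | center t == c]|)).
  rewrite mulnC -[X in (X * _)%N]sum1_size big_distrl/= big_seq [leqRHS]big_seq.
  by apply: leq_sum => c /mem_L /crit_fiber; rewrite mul1n.
rewrite card_fibers /tupcount -sum1_card; apply: leq_sum => t _.
by case: (_ \in _).
Qed.

(** Intruders are sought among indices: a copy of a vertex at another position violates the strict
    inequality and so counts as an intruder. *)
Let isolated : {set tup} := [set t in U |
  [forall j, (j \notin t) ==> (circumradius (rows (pt t)) < enorm (center t - nth 0 s j))]].

Lemma isolatedP (t : tup) : t \in isolated -> t \in U /\ forall j, j \notin t ->
  circumradius (rows (pt t)) < enorm (center t - nth 0 s j).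
Proof. by rewrite inE => /andP[tU /forallP h]; split=> // j; exact/implyP. Qed.

Lemma isolated_crit (t : tup) : t \in isolated ->
  crit (center t) /\ distfun S (center t) = circumradius (rows (pt t)).
Proof.
move=> /isolatedP[/tupsetP[ut [tfree ct cr]] tiso].
have [_ ceq] := circumcenterP tfree.
have mem_t i : rows (pt t) i \in s by rewrite rows_pt mem_nth.
have in_t p : p \in s -> ~ (exists i, p = rows (pt t) i) ->
    circumradius (rows (pt t)) < enorm (center t - p).
  move=> ps np; have pj : (index p s < size s)%N by rewrite index_mem.
  have -> : p = nth 0 s (Ordinal pj) by rewrite nth_index.
  apply: tiso; apply/negP => /tnthP[i ji]; apply: np; exists i.
  by rewrite rows_pt -ji nth_index.
have dE : distfun S (center t) = circumradius (rows (pt t)).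
  apply: distfunE; first exact: mem_t.
  move=> q qs; have [[i ->]|nq] := pselect (exists i, q = rows (pt t) i).
    by rewrite /center ceq.
  exact/ltW/in_t.
split=> //; split; last by rewrite dE.
exists (rows (pt t)); split=> //; first by move=> i; rewrite dE ceq.
by move=> p ps np; rewrite dE; exact: in_t.
Qed.

(** Isolated tuples with center [c] share the radius [distfun S c]. The vertices of one lie on the
    sphere of the other, so all its indices occur there, and only the order is free. *)
Lemma isolated_fiber c : (#|[set t in isolated | center t == c]| <= k.+1`!)%N.
Proof.
have [->|[t0]] := set_0Vmem [set t in isolated | center t == c]; first by rewrite cards0.
rewrite inE => /andP[t0iso /eqP t0c].
have [_ d0] := isolated_crit t0iso.
have [/tupsetP[ut0 _] iso0] := isolatedP t0iso.
rewrite -[X in X`!](size_tuple t0) -ffactnn -{1}(card_uniqP ut0) size_tuple.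
rewrite -card_uniq_tuples; apply: subset_leq_card; apply/fintype.subsetP => t.
rewrite inE => /andP[tiso /eqP tc]; rewrite inE.
have [_ dt] := isolated_crit tiso.
have [/tupsetP[ut [tfree _ _]] _] := isolatedP tiso.
rewrite ut andbT; apply/allP => j /tnthP[i ->]; apply/negPn/negP => /iso0.
have [_ ceq] := circumcenterP tfree.
by rewrite -d0 t0c -tc dt -rows_pt /center ceq ltxx.
Qed.

(** Isolated tuples are counted by the fibers over critical points. To any other good tuple an
    intruder is prepended; this is injective because [behead] recovers the tuple. *)
Lemma tupcount_le :
  (tupcount s (@good_tuples R k d r) <= k.+1`! * size L + tupcount s (@crowded R k d r))%N.
Proof.
rewrite /tupcount -/U -(cardsID isolated U); apply: leq_add.
  apply: (@leq_trans (\sum_(c <- L) #|[set t in isolated | center t == c]|)).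
    rewrite card_fibers -sum1_card; apply: (@leq_trans (\sum_(t in isolated) 1)).
      rewrite !sum1_card; apply: subset_leq_card; apply/fintype.subsetP => t.
      by rewrite finset.in_setI => /andP[].
    apply: leq_sum => t tiso; rewrite (_ : center t \in L)//.
    exact/mem_L/(isolated_crit tiso).1.
  rewrite mulnC -[X in (X * _)%N]sum1_size big_distrl/=.
  by apply: leq_sum => c _; rewrite mul1n; exact: isolated_fiber.
have intruder (t : tup) : t \in U :\: isolated -> exists j : 'I_(size s),
    j \notin t /\ enorm (center t - nth 0 s j) <= circumradius (rows (pt t)).
  rewrite finset.in_setD [X in ~~ X]inE => /andP[+ tU]; rewrite tU/= negb_forall.
  by move=> /existsP[j]; rewrite negb_imply -leNgt => /andP[]; exists j.
(* The option type supplies a value [None] where no intruder exists, so that a total function can be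
   chosen. *)
have /choice[g gP] : forall t : tup, exists o : option (k.+2.-tuple 'I_(size s)),
    t \in U :\: isolated -> exists2 W, o = Some W &
      W \in tupset s (@crowded R k d r) /\ behead W = t.
  move=> t; have [tA|ntA] := boolP (t \in U :\: isolated); last by exists None.
  have [j [jt cj]] := intruder t tA.
  exists (Some [tuple of j :: t]) => _; exists [tuple of j :: t] => //.
  have tU : t \in U by move: tA; rewrite finset.in_setD => /andP[].
  have /tupsetP[ut [_ _ cr]] := tU.
  split=> //; rewrite inE /= jt ut /=; apply/asboolP.
  have ptE : (pt [tuple of j :: t] : 'M[R]_(1 + k.+1, d)) = col_mx (nth 0 s j) (pt t).
    apply/matrixP => i l; rewrite mxE.
    have [i' ->|i' ->] := split_ordP i.
      by rewrite col_mxEu (ord1 i').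
    rewrite col_mxEd mxE (_ : rshift 1 i' = lift ord0 i') ?tnthS//.
    exact: ord_inj.
  rewrite /crowded/= ptE col_mxKu col_mxKd; split.
    by move: tU; rewrite inE => /andP[_ /asboolP].
  move=> l.
  have -> : (nth 0 s j) 0 l - pt t 0 l =
      (center t - rows (pt t) ord0) 0 l - (center t - nth 0 s j) 0 l.
    by rewrite !mxE; ring.
  apply: (le_trans (ler_normB _ _)); rewrite mulr_natl mulr2n.
  apply: lerD; apply: (le_trans (entry_le_enorm _ _)); first exact: cr.
  exact: (le_trans cj).
have g_inj : {in U :\: isolated &, injective g}.
  move=> t t' tA t'A gtt'; apply/val_inj.
  have [W gW [_ Wt]] := gP t tA; have [W' gW' [_ Wt']] := gP t' t'A.
  by move: gtt'; rewrite gW gW' => -[WW']; rewrite /= -Wt -Wt' WW'.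
rewrite -(card_in_imset g_inj) -[leqRHS](card_imset _ (@Some_inj _)).
apply: subset_leq_card; apply/fintype.subsetP => _ /imsetP[t tA ->].
by have [W -> [WC _]] := gP t tA; apply: imset_f.
Qed.

Lemma Ncrit_sandwich : exists N : nat, [/\ Ncrit S k r = N%:R%:E,
  (k.+1`! * N <= tupcount s (@good_tuples R k d r))%N &
  (tupcount s (@good_tuples R k d r) <= k.+1`! * N + tupcount s (@crowded R k d r))%N].
Proof.
by exists (size L); split; [exact: Ncrit_size|exact: Ncrit_le|exact: tupcount_le].
Qed.

End Sandwich.

(** * Factorial moments of random samples *)

Section MomentMeasure.
Variables (R : realType) (d m : nat).
Local Notation E m := (mxspace R m d).

Definition rect (A : 'I_m -> set (E 1)) : set (E m) := [set Y | forall i, A i (rows Y i)].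

Lemma mxbox_rect (a b : 'M[R]_(m, d)) :
  (mxbox a b : set (E m)) = rect (fun i => mxbox (row i a) (row i b)).
Proof.
apply/seteqP; split => Y /=; first by move=> h i i' j; rewrite !mxE; exact: h.
by move=> h i j; have := h i 0 j; rewrite !mxE.
Qed.

(** As a sum of Dirac masses the count inherits countable additivity in [B]. *)
Lemma tupcount_dirac (s : seq 'rV[R]_d) (B : set (E m)) :
  ((tupcount s B)%:R%:E = \sum_(t : m.-tuple 'I_(size s) | uniq t) \d_(pt t : E m) B :> \bar R)%E.
Proof.
rewrite /tupcount -sum1_card natr_sum -sumEFin /= big_mkcond [RHS]big_mkcond/=.
apply: eq_bigr => t _; rewrite inE; case: (uniq t) => //=.
rewrite /dirac indicE; case: asboolP => h; first by rewrite mem_set.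
by rewrite memNset.
Qed.

Lemma tupcountC (s : seq 'rV[R]_d) (B : set (E m)) :
  (tupcount s (~` B))%:R = (tupcount s (setT : set (E m)))%:R - (tupcount s B)%:R :> R.
Proof.
apply/eqP; rewrite eq_sym subr_eq -natrD eqr_nat; apply/eqP.
rewrite /tupcount -!sum1_card ![X in _ = X + _]big_mkcond ![X in _ = _ + X]big_mkcond/=.
rewrite [LHS]big_mkcond -big_split/=; apply: eq_bigr => t _; rewrite !inE.
case: (uniq t) => //=; rewrite asboolT//.
by case: asboolP => h; case: asboolP => h'; rewrite ?addn0 ?add0n//; case: h'.
Qed.

Lemma tupcount_bigcup (s : seq 'rV[R]_d) (F : nat -> set (E m)) :
  (forall i, measurable (F i)) -> trivIset setT F ->
  ((tupcount s (\bigcup_i F i))%:R%:E = \sum_(i <oo) (tupcount s (F i))%:R%:E :> \bar R)%E.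
Proof.
move=> mF tF; rewrite tupcount_dirac.
under [RHS]eq_eseriesr do rewrite tupcount_dirac.
rewrite nneseries_sum//.
apply: eq_bigr => t _; rewrite measure_bigcup//.
by apply: eq_eseriesl => i; rewrite in_setT.
Qed.

Context dO (Omega : measurableType dO) (P : {measure set Omega -> \bar R}).
Variable s : Omega -> seq 'rV[R]_d.

(** Measurability in the sample point is checked separately for each model, and only on products of
    sets; a Dynkin argument extends it. *)
Definition measurable_rect_counts := forall A : 'I_m -> set (E 1),
  (forall i, measurable (A i)) ->
  measurable_fun setT (fun w => (tupcount (s w) (rect A))%:R : R).

Hypothesis mrect : measurable_rect_counts.

Lemma measurable_tupcount (B : set (E m)) : measurable B ->
  measurable_fun setT (fun w => (tupcount (s w) B)%:R : R).
Proof.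
have mT : measurable_fun setT (fun w => (tupcount (s w) (setT : set (E m)))%:R : R).
  rewrite (_ : setT = rect (fun=> setT)); first exact: mrect.
  by apply/seteqP; split.
move=> mB; apply: (@dynkin_induction _ (E m) (@mxboxes R m d)
  (fun B => measurable_fun setT (fun w => (tupcount (s w) B)%:R : R))) => //.
- exact: setI_closed_mxboxes.
- move=> _ [a [b ->]]; rewrite mxbox_rect; apply: mrect => i; exact: measurable_mxbox.
- move=> A mA mTA; under eq_fun do rewrite tupcountC.
  exact: measurable_funB.
- move=> F mF tF mTF; apply/measurable_EFinP.
  rewrite (_ : _ \o _ = fun w => (\sum_(i <oo) (tupcount (s w) (F i))%:R%:E : \bar R)%E).
    by apply: ge0_emeasurable_sum => // i _; exact/measurable_EFinP.
  by apply/funext => w /=; rewrite tupcount_bigcup.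
Qed.

Definition moment (_ : measurable_rect_counts) (B : set (E m)) : \bar R :=
  (\int[P]_w (tupcount (s w) B)%:R%:E)%E.

Let moment0 : moment mrect set0 = 0%E.
Proof.
rewrite /moment; under eq_integral.
  move=> w _; rewrite tupcount_dirac big1; last by move=> t _; exact: measure0.
  over.
exact: integral0.
Qed.

Let moment_ge0 B : (0 <= moment mrect B)%E.
Proof. by apply: integral_ge0 => w _; rewrite lee_fin. Qed.

Let moment_sigma_additive : semi_sigma_additive (moment mrect).
Proof.
move=> F mF tF _; rewrite /moment.
under [X in _ --> X]eq_integral do rewrite tupcount_bigcup//.
rewrite integral_nneseries//; last first.
  by move=> n; apply/measurable_EFinP; exact: measurable_tupcount.
apply: is_cvg_ereal_nneg_natsum_cond => n _ _.
exact: moment_ge0.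
Qed.

HB.instance Definition _ := isMeasure.Build _ _ _
  (moment mrect) moment0 moment_ge0 moment_sigma_additive.

Variables (lam : {measure set (E 1) -> \bar R}) (hlam : is_lebesgue lam).
Variables (L : {measure set (E m) -> \bar R}) (hL : is_lebesgue L).
Variables (f : E 1 -> R) (mf : measurable_fun setT f) (f0 : forall x, 0 <= f x).
Hypothesis f1 : (\int[lam]_x (f x)%:E = 1)%E.

(** Both sides are measures in [B] that agree on boxes, and they are finite on cubes since the
    product density has mass 1. *)
Lemma momentE (c : R) : 0 <= c ->
  (forall A : 'I_m -> set (E 1), (forall i, measurable (A i)) ->
    (\int[P]_w (tupcount (s w) (rect A))%:R%:E
       = c%:E * \big[*%E/1]_(i < m) \int[lam]_(x in A i) (f x)%:E)%E) ->
  forall B : set (E m), measurable B ->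
    (\int[P]_w (tupcount (s w) B)%:R%:E = c%:E * \int[L]_(Y in B) (pdens f Y)%:E)%E.
Proof.
move=> c0 hrect B mB.
have mbox (a b : 'M[R]_(m, d)) : (moment mrect (mxbox a b)
    = c%:E * \int[L]_(Y in (mxbox a b : set (E m))) (pdens f Y)%:E)%E.
  rewrite mxbox_rect /moment hrect; last by move=> i; exact: measurable_mxbox.
  congr (_ * _)%E; rewrite -(dens_rows hlam mf f0 hL)//.
  by move=> i; exact: measurable_mxbox.
pose D := mscale (NngNum c0) (dens L (@measurable_pdens _ _ f mf m) (@pdens_ge0 _ _ f f0 m)).
rewrite -/(moment mrect B) (_ : (c%:E * _)%E = D B)//.
apply: mxspace_measure_unique => // [N|a b _]; last exact: mbox.
rewrite /cube [X in (X < _)%E]mbox; apply: (@le_lt_trans _ _ (c%:E * 1)%E); last by rewrite mule1 ltry.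
apply: lee_wpmul2l; first by rewrite lee_fin.
rewrite -(pdens_mass hlam hL mf f0 f1); apply: ge0_subset_integral => //.
- exact: measurable_mxbox.
- by apply/measurable_EFinP; exact: measurable_pdens.
- by move=> Y _; rewrite lee_fin pdens_ge0.
Qed.

End MomentMeasure.

(** * Factorial moments of the i.i.d. sample *)

Section IidCounts.
Variables (R : realType) (d m : nat).
Local Notation E m := (mxspace R m d).

(** The size of the sample equals [n] only propositionally; this transports index tuples to the
    fixed type ['I_n]. *)
Lemma tupcount_size n (s : seq 'rV[R]_d) (B : set (E m)) : size s = n ->
  tupcount s B = #|[set t : m.-tuple 'I_n | uniq t &
    `[< B (\matrix_(i < m, j < d) (nth 0 s (tnth t i)) 0 j) >]]%SET|.
Proof. by case: n /. Qed.

Context dO (Omega : measurableType dO) (P : probability Omega R).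
Variables (lam : {measure set (E 1) -> \bar R}) (f : E 1 -> R).
Variables (X : nat -> Omega -> E 1) (mX : forall i, measurable_fun setT (X i)).
Hypothesis hXf : forall i (A : set (E 1)), measurable A ->
  P (X i @^-1` A) = (\int[lam]_(x in A) (f x)%:E)%E.
Hypothesis hXind : mutually_independent P X.

Definition sample n w : seq 'rV[R]_d := [seq X i w : 'rV[R]_d | i <- iota 0 n].

Let hit n (A : 'I_m -> set (E 1)) (t : m.-tuple 'I_n) : set Omega :=
  \bigcap_(i in [set: 'I_m]) (X (tnth t i) @^-1` A i).

Let measurable_hit n A t : (forall i, measurable (A i)) -> measurable (@hit n A t).
Proof.
move=> mA; apply: fin_bigcap_measurable => [|i _]; first exact: finite_finset.
by rewrite -[X in measurable X]setTI; exact: mX.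
Qed.

Let sample_countE n (A : 'I_m -> set (E 1)) w :
  (tupcount (sample n w) (rect A))%:R = \sum_(t : m.-tuple 'I_n | uniq t) \1_(hit A t) w :> R.
Proof.
rewrite (@tupcount_size n) ?size_map ?size_iota// -sum1_card natr_sum.
rewrite big_mkcond [RHS]big_mkcond/=; apply: eq_bigr => t _; rewrite inE.
case: (uniq t) => //=; rewrite indicE.
have E1 i : nth 0 (sample n w) (tnth t i) = X (tnth t i) w.
  by rewrite (nth_map 0%N) ?size_iota// nth_iota.
case: asboolP => h.
  rewrite mem_set// => i _ /=; have := h i; congr (A i).
  by apply/rowP => j; rewrite !mxE E1.
rewrite memNset// => h'; apply: h => i; have := h' i I => /=; congr (A i).
by apply/rowP => j; rewrite !mxE E1.
Qed.

Lemma measurable_sample_counts n : @measurable_rect_counts R d m _ Omega (sample n).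
Proof.
move=> A mA; under eq_fun do rewrite sample_countE.
under eq_fun do rewrite big_mkcond.
apply: measurable_sum => t; case: (uniq t) => //.
by apply: measurable_indic; exact: measurable_hit.
Qed.

Let prob_hit n (A : 'I_m -> set (E 1)) (t : m.-tuple 'I_n) :
  (forall i, measurable (A i)) -> uniq t ->
  (P (hit A t) = \big[*%E/1]_(i < m) \int[lam]_(x in A i) (f x)%:E)%E.
Proof.
move=> mA ut.
(* Independence expects sets indexed by sample indices. As [t] is injective, index [tnth t i] can
   carry [A i], and indices outside [t] carry the whole space. *)
pose A' j : set (E 1) := if [pick i | val (tnth t i) == j] is Some i then A i else setT.
have A't i : A' (tnth t i) = A i.
  rewrite /A'; case: pickP => [i' /eqP/val_inj|/(_ i)]; last by rewrite eqxx.
  by move=> /(tuple_uniqP _ ut) ->.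
have mA' j : measurable (A' j) by rewrite /A'; case: pickP.
have ut' : uniq [seq val i | i <- t] by rewrite map_inj_uniq//; exact: val_inj.
have := hXind ut' mA'.
rewrite big_map big_tuple (_ : \bigcap_(i in _) _ = hit A t).
  by move=> ->; apply: eq_bigr => i _; rewrite A't hXf.
apply/seteqP; split => w h.
  move=> i _ /=; rewrite -A't; apply: (h (tnth t i)) => /=.
  by apply: map_f; exact: mem_tnth.
move=> _ /= /mapP[_ /tnthP[i ->] ->]; rewrite A't; exact: h.
Qed.

(** All [n ^_ m] injective index tuples have the same hitting probability. *)
Lemma sample_moment n (A : 'I_m -> set (E 1)) : (forall i, measurable (A i)) ->
  (\int[P]_w (tupcount (sample n w) (rect A))%:R%:E
    = (n ^_ m)%:R%:E * \big[*%E/1]_(i < m) \int[lam]_(x in A i) (f x)%:E)%E.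
Proof.
move=> mA; under eq_integral do rewrite sample_countE -sumEFin big_mkcond/=.
rewrite ge0_integral_sum//; last 2 first.
- move=> t; case: (uniq t) => //; apply/measurable_EFinP; apply: measurable_indic.
  exact: measurable_hit.
- by move=> t w _; case: (uniq t); rewrite // lee_fin.
have -> : (\big[*%E/1]_(i < m) \int[lam]_(x in A i) (f x)%:E
    = (\prod_(i < m) fine (P (X 0 @^-1` A i)))%:E)%E.
  rewrite -prodEFin; apply: eq_bigr => i _; rewrite fineK ?hXf//.
  rewrite -(hXf 0)// fin_num_measure//.
  by rewrite -[X in measurable X]setTI; exact: mX.
set c := \prod_(i < m) _.
transitivity (\sum_(t : m.-tuple 'I_n | uniq t) c%:E)%E.
  rewrite [RHS]big_mkcond/=; apply: eq_bigr => t _.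
  have [ut|_] := boolP (uniq t); last exact: integral0.
  rewrite integral_indic//; last exact: measurable_hit.
  rewrite setIT [LHS](prob_hit mA ut) /c -prodEFin; apply: eq_bigr => i _.
  rewrite fineK ?hXf// -(hXf 0)// fin_num_measure//.
  by rewrite -[X in measurable X]setTI; exact: mX.
rewrite sumEFin -EFinM sumr_const -[X in c *+ X](_ : n ^_ m = _) ?mulr_natl//.
rewrite -{1}(card_ord n) -[LHS](card_uniq_tuples m predT) cardsE.
by apply: eq_card => t; rewrite [LHS]inE [RHS]inE all_predT.
Qed.

End IidCounts.

(** * Factorial moments of the Poisson process *)

Lemma big_tuple_cons (R : Type) (idx : R) (op : Monoid.com_law idx) (T : finType) m
    (F : m.+1.-tuple T -> R) :
  \big[op/idx]_(t : m.+1.-tuple T) F t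
    = \big[op/idx]_(x : T) \big[op/idx]_(t : m.-tuple T) F [tuple of x :: t].
Proof.
rewrite pair_big/= (reindex (fun p : T * m.-tuple T => [tuple of p.1 :: p.2]))//=.
exists (fun t => (thead t, [tuple of behead t])) => [[x t] _|t _] /=.
  by rewrite theadE; congr pair; apply/val_inj.
by rewrite -tuple_eta.
Qed.

Section ColoredTuples.
Variables (T K : finType) (col : T -> option K).

Definition colored (D : {set T}) (S : K) : nat := #|[set x in D | col x == Some S]%SET|.

(** Choosing the first entry uses up one element of its colour, which is the recursion of the
    falling factorial. The set [D] of remaining elements varies in the induction. *)
Lemma card_colored_tuples m (sigma : m.-tuple K) (D : {set T}) :
  #|[set t : m.-tuple T | [&& uniq t, all (mem D) t & map col t == map Some sigma]]%SET|
  = (\prod_(S : K) (colored D S) ^_ (count_mem S sigma))%N.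
Proof.
elim: m sigma D => [|m IH] sigma D.
  rewrite (tuple0 sigma) big1 => [|S _]; last exact: ffactn0.
  apply/eqP/cards1P; exists [tuple].
  by apply/setP => t; rewrite (tuple0 t) !inE eqxx.
case/tupleP: sigma => S0 sigma.
rewrite -sum1dep_card big_mkcond big_tuple_cons/=.
transitivity (\sum_(x in [set x in D | col x == Some S0])
   \prod_(S : K) (colored (D :\ x) S) ^_ (count_mem S sigma))%N.
  rewrite [RHS]big_mkcond/=; apply: eq_bigr => x _.
  rewrite inE; case: ifPn => [/andP[xD /eqP xS0]|xN].
    rewrite -IH -sum1dep_card [RHS]big_mkcond; apply: eq_bigr => t _.
    rewrite xD xS0 eqseq_cons eqxx/=; congr (if _ then _ else _).
    rewrite -andbA; have [xt|xt] := boolP (x \in t).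
      apply/esym/negbTE; rewrite !negb_and; apply/orP; right; apply/orP; left.
      by apply/allPn; exists x => //; rewrite !inE eqxx.
    rewrite /=; congr [&& _, _ & _]; apply: eq_in_all => y yt; rewrite !inE.
    by rewrite (_ : y != x)//; apply: contraNneq xt => <-.
  rewrite big1// => t _; case: ifP => // /and3P[_ /andP[xD _]].
  by rewrite eqseq_cons => /andP[xS0 _]; move: xN; rewrite xD xS0.
have c0 x S : x \in [set x in D | col x == Some S0] ->
    colored (D :\ x) S = (colored D S - (S == S0))%N.
  rewrite inE => /andP[xD /eqP xS0]; have [->|SS0] := eqVneq S S0.
    rewrite /colored (cardsD1 x [set _ in D | _]) !inE xD xS0 eqxx/= add1n subn1/=.
    by apply: eq_card => y; rewrite !inE andbA.
  rewrite subn0; apply: eq_card => y; rewrite !inE; case: eqP => //= ->.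
  by rewrite xD xS0; apply/esym/negbTE; apply: contra_neqN SS0 => /eqP[].
under eq_bigr => x xD do under eq_bigr do rewrite c0//.
rewrite sum_nat_const -/(colored D S0).
rewrite (bigD1 S0)//= [RHS](bigD1 S0)//= !eqxx subn1 mulnA add1n ffactnS.
congr (_ * _)%N; apply: eq_bigr => S /negPf SS0.
by rewrite SS0 subn0 (eq_sym S0) SS0.
Qed.

End ColoredTuples.

Section ProductLaw.
Context (R : realType) d (Omega : measurableType d) (P : {measure set Omega -> \bar R}).
Variables (K : finType) (N : K -> Omega -> nat) (p : K -> nat -> R).
Hypothesis mN : forall S j, measurable [set w | N S w = j].
Hypothesis p0 : forall S j, 0 <= p S j.
Hypothesis jointN : forall j : K -> nat,
  P (\bigcap_(S in [set: K]) [set w | N S w = j S]) = (\prod_S p S (j S))%:E.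

Lemma measurable_of_count (G : nat -> R) S : measurable_fun setT (fun w => G (N S w)).
Proof.
move=> _ A mA; rewrite setTI.
rewrite (_ : _ @^-1` A = \bigcup_(j in G @^-1` A) [set w | N S w = j]).
  exact: bigcup_measurable.
apply/seteqP; split => w /=; first by move=> h; exists (N S w).
by move=> [j jA ->].
Qed.

(** Only the joint probabilities of the counts are known. [F s j] interpolates: colours in [s] carry
    [G], the others the indicator of a prescribed value, and colours enter [s] one at a time. *)
Lemma expectation_prod_counts (G : K -> nat -> R) (e : K -> R) :
  (forall S j, 0 <= G S j) ->
  (forall S, (\sum_(j <oo) (G S j * p S j)%:E = (e S)%:E)%E) ->
  (\int[P]_w (\prod_S G S (N S w))%:E = (\prod_S e S)%:E)%E.
Proof.
move=> G0 eG.
pose F (s : seq K) (j : K -> nat) w :=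
  \prod_S (if S \in s then G S (N S w) else (N S w == j S)%:R) : R.
suff main (s : seq K) (j : K -> nat) : uniq s -> (\int[P]_w (F s j w)%:E
    = (\prod_S (if S \in s then e S else p S (j S)))%:E)%E.
  have := main (enum K) (fun=> 0%N) (enum_uniq K).
  under [X in _ = X%:E -> _]eq_bigr do rewrite mem_enum.
  move=> <-; apply: eq_integral => w _; congr _%:E.
  by apply: eq_bigr => S _; rewrite mem_enum.
have mF s' j' : measurable_fun setT (F s' j').
  apply: measurable_prod => S _; case: (S \in s').
    exact: measurable_of_count.
  exact: (@measurable_of_count (fun i => (i == j' S)%:R) S).
have F0 s' j' w : 0 <= F s' j' w.
  by apply: prodr_ge0 => S _; case: (S \in s').
elim: s j => [|S0 s IH] j /=.
  move=> _; rewrite -jointN -[X in _ = P X]setIT -(integral_indic P measurableT).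
    apply: eq_integral => w _; rewrite /F indicE; congr _%:E.
    have [h|h] := pselect (forall S, N S w = j S).
      rewrite mem_set//=; last by move=> S _; exact: h.
      by apply: big1 => S _; rewrite h eqxx.
    have [S hS] : exists S, N S w != j S.
      by apply: contrapT => h'; apply: h => S; apply/eqP/negPn/negP => n; apply: h'; exists S.
    rewrite memNset; last by move=> /(_ S I)/eqP; rewrite (negPf hS).
    by rewrite (bigD1 S)//= (negPf hS) mul0r.
  apply: fin_bigcap_measurable => //; exact: finite_finset.
move=> /andP[S0s us].
pose j' i S := if S == S0 then i else j S.
(* The factor of colour [S0] is decomposed over the values [i] of its count; only one term survives
   at each [w]. *)
transitivity (\int[P]_w \sum_(i <oo) (G S0 i * F s (j' i) w)%:E)%E.
  apply: eq_integral => w _.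
  rewrite (@nneseriesD1 _ _ (N S0 w))//; last by move=> i _; rewrite lee_fin mulr_ge0.
  rewrite eseries0 ?adde0.
    congr _%:E; rewrite /F (bigD1 S0)//= mem_head [X in G _ _ * X](bigD1 S0)//=.
    rewrite (negPf S0s) /j' eqxx eqxx mul1r; congr (_ * _).
    by apply: eq_bigr => S SS0; rewrite in_cons (negPf SS0).
  move=> i _ iN; rewrite /F (bigD1 S0)//= (negPf S0s) /j' eqxx eq_sym.
  by rewrite (negPf iN) mul0r mulr0.
rewrite integral_nneseries//; last 2 first.
- by move=> i; apply/measurable_EFinP; apply: measurable_funM => //; exact: mF.
- by move=> i w _; rewrite lee_fin mulr_ge0.
rewrite (bigD1 S0)//= mem_head EFinM -eG muleC -nneseriesZl; last first.
  by move=> i _; rewrite lee_fin mulr_ge0.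
apply: eq_eseriesr => i _.
under eq_integral do rewrite EFinM.
rewrite ge0_integralZl_EFin//; last 2 first.
- by move=> w _; rewrite lee_fin.
- exact/measurable_EFinP.
rewrite IH// -!EFinM (bigD1 S0)//= (negPf S0s) /j' eqxx mulrA mulrC; congr (_ * _)%:E.
by apply: eq_bigr => S SS0; rewrite in_cons (negPf SS0).
Qed.

End ProductLaw.

(** Terms with [j < a] vanish; after a shift by [a], the quotient [j ^_ a / j!] is [1 / (j - a)!]
    and the exponential series remains. *)
Lemma poisson_factorial_moment (R : realType) (lambda : R) (a : nat) : 0 <= lambda ->
  (\sum_(j <oo) ((j ^_ a)%:R * poisson_pmf' lambda j)%:E = (lambda ^+ a)%:E)%E.
Proof.
move=> l0; apply/cvg_lim => //.
under eq_fun do rewrite sumEFin.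
apply/cvg_EFin; first exact: nearW.
rewrite -(cvg_shiftn a) /=.
have -> : (fun n => \sum_(0 <= j < n + a) (j ^_ a)%:R * poisson_pmf' lambda j)
   = (fun n => lambda ^+ a * expR (- lambda) * series (exp_coeff lambda) n).
  apply/funext => n; rewrite addnC (big_cat_nat (n := a))//=; last exact: leq_addr.
  rewrite big_nat big1 ?add0r; last first.
    by move=> i /andP[_ ia]; rewrite ffact_small// mul0r.
  rewrite -{1}[a]add0n big_addn addKn /series/= mulr_sumr.
  apply: eq_bigr => i _; rewrite /poisson_pmf' /exp_coeff/= exprD.
  have := ffact_fact (leq_addl i a); rewrite addnK => /(congr1 (fun k => k%:R : R)).
  rewrite natrM => <-.
  have i0 : (i`!%:R : R) != 0 by rewrite pnatr_eq0 -lt0n fact_gt0.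
  have j0 : (((i + a) ^_ a)%:R : R) != 0 by rewrite pnatr_eq0 -lt0n ffact_gt0 leq_addl.
  by field; rewrite i0 j0.
set C := lambda ^+ a * expR (- lambda).
have <- : C * expR lambda = lambda ^+ a by rewrite /C -mulrA -expRD addNr expR0 mulr1.
by apply: cvgMr; exact: is_cvg_series_exp_coeff.
Qed.

Lemma prod_exp_count (R : comRingType) (K : finType) (F : K -> R) (s : seq K) :
  \prod_(S : K) F S ^+ count_mem S s = \prod_(S <- s) F S.
Proof.
elim: s => [|S0 s IH]; first by rewrite big_nil big1.
rewrite big_cons -IH (bigD1 S0)//= [in RHS](bigD1 S0)//= eqxx exprS mulrA; congr (_ * _).
by apply: eq_bigr => S /negPf SS0; rewrite (eq_sym S0) SS0 add0n.
Qed.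

Section Atoms.
Variables (R : realType) (d m : nat).
Local Notation E := (mxspace R 1 d).

(** Each index is coloured by the cell containing its point, or by [None]; tuples in the product of
    cells are those with colour sequence [sigma]. *)
Lemma tupcount_disjoint (K : finType) (C : K -> set E) (s : seq 'rV[R]_d)
    (sigma : {ffun 'I_m -> K}) :
  (forall S S', S != S' -> C S `&` C S' = set0) ->
  tupcount s (rect (fun i => C (sigma i)))
    = (\prod_S (count_in (C S) s) ^_ (count_mem S (fgraph sigma)))%N.
Proof.
move=> tC.
pose col (j : 'I_(size s)) := [pick S | `[< C S (nth 0 s j) >]].
have colE j S : (col j == Some S) = `[< C S (nth 0 s j) >].
  rewrite /col; case: pickP => [S' /asboolP CS'|/(_ S) ->//].
  apply/eqP/asboolP => [[<-]//|CS].
  have [->//|/tC] := eqVneq S' S.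
  by move=> /seteqP[/(_ (nth 0 s j))] + _ => /(_ (conj CS' CS)).
have colored_count S : colored col [set: 'I_(size s)]%SET S = count_in (C S) s.
  rewrite /count_in -sum1_count (big_nth 0) big_mkord /colored -sum1dep_card.
  by apply: eq_bigl => j; rewrite !inE colE.
have [sg sgE sgi] : exists2 sg : m.-tuple K,
    forall S, count_mem S sg = count_mem S (fgraph sigma) & forall i, tnth sg i = sigma i.
  exists [tuple sigma i | i < m] => [S|i]; first by rewrite fgraph_codom.
  by rewrite tnth_mktuple.
under [RHS]eq_bigr do rewrite -colored_count -sgE.
rewrite -card_colored_tuples; apply: eq_card => t; rewrite !inE.
case: (uniq t) => //=.
have -> : all (mem [set: 'I_(size s)]%SET) t by apply/allP => j _; rewrite !inE.
apply/asboolP/eqP => [h|h].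
  apply/(@eq_from_nth _ None) => [|i]; first by rewrite !size_map !size_tuple.
  rewrite size_map size_tuple => im.
  have := h (Ordinal im); rewrite rows_pt => /asboolP; rewrite -colE => /eqP ci.
  have tn x0 : nth x0 t i = tnth t (Ordinal im) by rewrite (tnth_nth x0).
  have sgn S : nth S sg i = sigma (Ordinal im) by rewrite -sgi (tnth_nth S).
  rewrite (nth_map (tnth t (Ordinal im))) ?size_tuple// tn ci.
  by rewrite (nth_map (sigma (Ordinal im))) ?size_tuple// sgn.
move=> i; rewrite rows_pt; apply/asboolP; rewrite -colE; apply/eqP.
have := congr1 (fun u => nth None u i) h.
rewrite (nth_map (tnth t i)) ?size_tuple// -tnth_nth => ->.
rewrite (nth_map (sigma i)) ?size_tuple//.
by rewrite -tnth_nth sgi.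
Qed.

Variable A : 'I_m -> set E.

(** These cells partition the space, and the Poisson hypothesis applies to them since they are
    disjoint, while the [A i] may overlap. *)
Definition atom (S : {set 'I_m}) : set E := [set x | forall i, (i \in S) = `[< A i x >]].

Lemma atom_disjoint S S' : S != S' -> atom S `&` atom S' = set0.
Proof.
move=> SS'; apply/seteqP; split=> // x [h h']; move/eqP: SS'; apply.
by apply/setP => i; rewrite h h'.
Qed.

Lemma measurable_atom S : (forall i, measurable (A i)) -> measurable (atom S).
Proof.
move=> mA; rewrite (_ : atom S = \bigcap_(i in [set: 'I_m]) (if i \in S then A i else ~` A i)).
  apply: fin_bigcap_measurable => [|i _]; first exact: finite_finset.
  by case: ifP => // _; exact: measurableC.
apply/seteqP; split => x /= h i.
  by move=> _; have := h i; case: (i \in S) => /esym /asboolP.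
have := h i I; case: (i \in S) => h'; first by rewrite asboolT.
by rewrite asboolF.
Qed.

Lemma indic_atoms i x :
  \1_(A i) x = \sum_(S : {set 'I_m} | i \in S) \1_(atom S) x :> R.
Proof.
pose Sx := [set l | `[< A l x >]]%SET.
have xS S : \1_(atom S) x = (S == Sx)%:R :> R.
  rewrite indicE; congr (nat_of_bool _)%:R; apply/idP/eqP => [|->].
    by rewrite inE => h; apply/setP => l; rewrite h !inE.
  by rewrite inE => l; rewrite !inE.
under eq_bigr do rewrite xS.
have iS : (i \in Sx) = `[< A i x >] by rewrite inE.
rewrite indicE; have [Aix|nAix] := pselect (A i x).
  rewrite mem_set// (bigD1 Sx)/=; last by rewrite iS asboolT.
  by rewrite eqxx big1 ?addr0// => S /andP[_ /negPf ->].
rewrite memNset// big1// => S iinS; case: eqP => // SE.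
by move: iinS; rewrite SE iS asboolF.
Qed.

(** A tuple lies in exactly one product of atoms, recording for every position which of the [A l]
    contain its point. *)
Lemma tupcount_atoms (s : seq 'rV[R]_d) :
  tupcount s (rect A) = (\sum_(sigma in family (fun i => [pred S : {set 'I_m} | i \in S]))
     tupcount s (rect (fun i => atom (sigma i))))%N.
Proof.
rewrite /tupcount -sum1_card.
under [RHS]eq_bigr do rewrite -sum1_card big_mkcond/=.
rewrite exchange_big/= big_mkcond/=; apply: eq_bigr => t _; rewrite inE.
case ut : (uniq t) => /=; last by rewrite big1// => sigma _; rewrite inE ut.
pose sg : {ffun 'I_m -> {set 'I_m}} := [ffun i => [set l | `[< A l (rows (pt t) i) >]]%SET].
have E1 (sigma : {ffun 'I_m -> {set 'I_m}}) :
    (t \in tupset s (rect (fun i => atom (sigma i)))) = (sigma == sg).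
  rewrite inE ut; apply/asboolP/eqP => [h|-> i l]; last by rewrite ffunE inE.
  by apply/ffunP => i; rewrite ffunE; apply/setP => l; rewrite inE (h i l).
under eq_bigr do rewrite E1.
have sgF : (sg \in family (fun i => [pred S : {set 'I_m} | i \in S])) = `[< rect A (pt t) >].
  apply/familyP/asboolP => h i; have := h i; rewrite !inE ffunE inE; first by move/asboolP.
  by move=> ?; apply/asboolP.
case: asboolP => h.
  rewrite (bigD1 sg)/=; last by rewrite sgF asboolT.
  by rewrite eqxx big1 ?addn0// => sigma /andP[_ /negPf ->].
rewrite big1// => sigma sF; case: eqP => // sE.
by move: sF; rewrite sE sgF asboolF.
Qed.

End Atoms.

Section PoissonCounts.
Variables (R : realType) (d m : nat).
Local Notation E m := (mxspace R m d).
Context dO (Omega : measurableType dO) (P : probability Omega R).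
Variables (lam : {measure set (E 1) -> \bar R}).
Variables (f : E 1 -> R) (mf : measurable_fun setT f) (f0 : forall x, 0 <= f x).
Hypothesis f1 : (\int[lam]_x (f x)%:E = 1)%E.
Variables (n : nat) (PP : Omega -> seq 'rV[R]_d).
Hypothesis hPP : is_poisson_process P lam (fun x => n%:R * f x) PP.

Let mean (A : set (E 1)) : R := fine (\int[lam]_(x in A) (n%:R * f x)%:E)%E.

Let int_f A : measurable A -> (\int[lam]_(x in A) (f x)%:E \is a fin_num)%E.
Proof.
move=> mA; rewrite ge0_fin_numE; last by apply: integral_ge0 => x _; rewrite lee_fin.
apply: (@le_lt_trans _ _ 1%E); last exact: ltry.
rewrite -f1; apply: ge0_subset_integral => //; first exact/measurable_EFinP.
by move=> x _; rewrite lee_fin.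
Qed.

Let meanE A : measurable A -> (\int[lam]_(x in A) (n%:R * f x)%:E = (mean A)%:E)%E /\
  mean A = n%:R * fine (\int[lam]_(x in A) (f x)%:E).
Proof.
move=> mA; rewrite /mean.
have -> : (\int[lam]_(x in A) (n%:R * f x)%:E = n%:R%:E * \int[lam]_(x in A) (f x)%:E)%E.
  under eq_integral do rewrite EFinM.
  rewrite ge0_integralZl_EFin//.
    by move=> x _; rewrite lee_fin.
  by apply: measurable_funTS; exact/measurable_EFinP.
by rewrite -(fineK (int_f mA)).
Qed.

Let mean_ge0 A : 0 <= mean A.
Proof. by apply/fine_ge0/integral_ge0 => x _; rewrite lee_fin mulr_ge0. Qed.

Let joint_counts (K : finType) (C : K -> set (E 1)) (j : K -> nat) :
  (forall S, measurable (C S)) -> (forall S S', S != S' -> C S `&` C S' = set0) ->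
  P (\bigcap_(S in [set: K]) [set w | count_in (C S) (PP w) = j S])
    = (\prod_S poisson_pmf' (mean (C S)) (j S))%:E.
Proof.
move=> mC tC.
have := hPP.2 #|K| (fun l => C (enum_val l)) (fun l => j (enum_val l)).
rewrite (_ : \bigcap_l _ = \bigcap_(S in [set: K]) [set w | count_in (C S) (PP w) = j S]).
  move=> -> //; last first.
    by move=> l l' ll'; apply: tC; apply: contra_neq ll'; exact: enum_val_inj.
  congr _%:E; rewrite [RHS](reindex (fun l : 'I_#|K| => enum_val l))//.
  by exists enum_rank => ? _; [exact: enum_valK|exact: enum_rankK].
apply/seteqP; split => w /= h S _; last exact: h.
by have := h (enum_rank S) I; rewrite /= enum_rankK.
Qed.

Lemma tupcount_atomsE (A : 'I_m -> set (E 1)) (s : seq 'rV[R]_d) : (tupcount s (rect A))%:R =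
  \sum_(sigma in family (fun i => [pred S : {set 'I_m} | i \in S]))
     \prod_S ((count_in (atom A S) s) ^_ (count_mem S (fgraph sigma)))%:R :> R.
Proof.
rewrite tupcount_atoms natr_sum; apply: eq_bigr => sigma _.
by rewrite tupcount_disjoint ?natr_prod//; exact: atom_disjoint.
Qed.

Lemma measurable_poisson_counts : @measurable_rect_counts R d m _ Omega PP.
Proof.
move=> A mA; under eq_fun do rewrite tupcount_atomsE.
under eq_fun do rewrite big_mkcond.
apply: measurable_sum => sigma; case: (sigma \in _) => //.
apply: measurable_prod => S _.
apply: (@measurable_of_count R _ Omega {set 'I_m} (fun S w => count_in (atom A S) (PP w)) _
  (fun j => (j ^_ (count_mem S (fgraph sigma)))%:R)) => S' j.
by apply: hPP.1; exact: measurable_atom.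
Qed.

(** Factorial moments of the independent atom counts give a product of means for each [sigma].
    Summing over [sigma] distributes into a product over positions, and the atoms inside [A i] add
    up to its mean. *)
Lemma poisson_moment (A : 'I_m -> set (E 1)) : (forall i, measurable (A i)) ->
  (\int[P]_w (tupcount (PP w) (rect A))%:R%:E
    = (n%:R ^+ m)%:E * \big[*%E/1]_(i < m) \int[lam]_(x in A i) (f x)%:E)%E.
Proof.
move=> mA.
have mC S : measurable (atom A S) by exact: measurable_atom.
pose N S w := count_in (atom A S) (PP w).
have mN S j : measurable [set w | N S w = j] by exact: hPP.1.
pose F (sigma : {ffun 'I_m -> {set 'I_m}}) w : R :=
  \prod_S ((N S w) ^_ (count_mem S (fgraph sigma)))%:R.
have mF sigma : measurable_fun setT (F sigma).
  apply: measurable_prod => S _.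
  exact: (@measurable_of_count R _ Omega _ N mN
    (fun j => (j ^_ (count_mem S (fgraph sigma)))%:R)).
have F0 sigma w : 0 <= F sigma w by apply: prodr_ge0.
under eq_integral do rewrite tupcount_atomsE -sumEFin big_mkcond/=.
rewrite ge0_integral_sum//; last 2 first.
- by move=> sigma; case: (sigma \in _) => //; apply/measurable_EFinP; exact: (mF sigma).
- by move=> sigma w _; case: (sigma \in _); rewrite lee_fin//; exact: F0.
have IF sigma : (\int[P]_w (F sigma w)%:E = (\prod_i mean (atom A (sigma i)))%:E)%E.
  rewrite (@expectation_prod_counts R _ Omega P _ N (fun S => poisson_pmf' (mean (atom A S)))
    mN _ _ (fun S j => (j ^_ (count_mem S (fgraph sigma)))%:R)
    (fun S => mean (atom A S) ^+ count_mem S (fgraph sigma)))//.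
  - by rewrite prod_exp_count fgraph_codom/= /codom /image_mem big_map big_enum.
  - move=> S j; rewrite /poisson_pmf' mulr_ge0 ?expR_ge0// divr_ge0// exprn_ge0//.
  - by move=> j; apply: joint_counts => //; exact: atom_disjoint.
  - by move=> S; apply: poisson_factorial_moment; exact: mean_ge0.
transitivity (\sum_(sigma in family (fun i => [pred S : {set 'I_m} | i \in S]))
    (\prod_i mean (atom A (sigma i)))%:E)%E.
  rewrite [RHS]big_mkcond/=; apply: eq_bigr => sigma _.
  by case: (sigma \in _); [exact: IF|exact: integral0].
rewrite sumEFin -(bigA_distr_big_dep _ (fun i S => mean (atom A S))).
have meanA i : \sum_(S : {set 'I_m} | i \in S) mean (atom A S) = mean (A i).
  apply: EFin_inj; rewrite -sumEFin -(meanE (mA i)).1.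
  under eq_bigr do rewrite -(meanE (mC _)).1 integral_in_indic.
  rewrite big_mkcond integral_in_indic.
  under [RHS]eq_integral do rewrite (indic_atoms A) mulr_sumr -sumEFin big_mkcond/=.
  rewrite ge0_integral_sum//; last 2 first.
  - move=> S; case: (i \in S) => //; apply/measurable_EFinP; apply: measurable_funM.
      exact: measurable_funM.
    exact: measurable_indic.
  - by move=> S x _; case: (i \in S); rewrite lee_fin// !mulr_ge0.
  by apply: eq_bigr => S _; case: (i \in S) => //; rewrite integral0.
under eq_bigr => i _ do rewrite (meanA i) (meanE (mA i)).2.
rewrite big_split/= prodr_const card_ord EFinM; congr (_ * _)%E.
by rewrite -prodEFin; apply: eq_bigr => i _; rewrite fineK// int_f.
Qed.

End PoissonCounts.

(** * The limit theorem *)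

(* The integral of a nonnegative function is its lower integral, so monotonicity
   needs no measurability; it is applied to [Ncrit], whose measurability is not needed. *)
Lemma le_lower_integral d (T : measurableType d) (R : realType)
    (mu : {measure set T -> \bar R}) (g1 g2 : T -> \bar R) :
  (forall x, (0 <= g1 x)%E) -> (forall x, (g1 x <= g2 x)%E) ->
  (\int[mu]_x g1 x <= \int[mu]_x g2 x)%E.
Proof.
move=> g10 g12; have g20 x : (0 <= g2 x)%E by exact: le_trans (g12 x).
rewrite !ge0_integralTE//; apply: le_ereal_sup => _ [h /= hg <-].
by exists h => // x; exact: le_trans (g12 x).
Qed.

Section CountLimit.
Variables (R : realType) (d k : nat).
Local Notation E m := (mxspace R m d).
Variables (lam : {measure set (E 1) -> \bar R}) (hlam : is_lebesgue lam).
Variables (lamk : {measure set (E k) -> \bar R}) (hlamk : is_lebesgue lamk).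
Variables (L : {measure set (E k.+1) -> \bar R}) (hL : is_lebesgue L).
Variables (L2 : {measure set (E k.+2) -> \bar R}) (hL2 : is_lebesgue L2).
Variables (f : E 1 -> R) (mf : measurable_fun setT f) (f0 : forall x, 0 <= f x).
Hypothesis f1 : (\int[lam]_x (f x)%:E = 1)%E.
Variables (B : R) (B1 : 1 <= B) (fB : forall x, f x <= B).
Context dO (Omega : measurableType dO) (P : probability Omega R).
Variables (pts : nat -> Omega -> seq 'rV[R]_d) (c1 c2 : nat -> R).
Variables (r : nat -> R) (r0 : forall n, 0 < r n) (rcvg : r @ \oo --> 0).
Hypothesis hnr : (fun n => n%:R * r n ^+ d) @ \oo --> 0.
Hypothesis c1_ge0 : forall n, 0 <= c1 n.
Hypothesis c1_cvg : (fun n => c1 n / n%:R ^+ k.+1) @ \oo --> (1 : R).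
Hypothesis c2_ge0 : forall n, 0 <= c2 n.
Hypothesis c2_le : forall n, c2 n <= n%:R ^+ k.+2.
Hypothesis m1 : forall n, @measurable_rect_counts R d k.+1 _ Omega (pts n).
Hypothesis m2 : forall n, @measurable_rect_counts R d k.+2 _ Omega (pts n).
Hypothesis e1 : forall n (A : 'I_k.+1 -> set (E 1)), (forall i, measurable (A i)) ->
  (\int[P]_w (tupcount (pts n w) (rect A))%:R%:E
    = (c1 n)%:E * \big[*%E/1]_(i < k.+1) \int[lam]_(x in A i) (f x)%:E)%E.
Hypothesis e2 : forall n (A : 'I_k.+2 -> set (E 1)), (forall i, measurable (A i)) ->
  (\int[P]_w (tupcount (pts n w) (rect A))%:R%:E
    = (c2 n)%:E * \big[*%E/1]_(i < k.+2) \int[lam]_(x in A i) (f x)%:E)%E.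

Let G n : set (E k.+1) := good_tuples (r n).
Let C n : set (E k.+2) := crowded (r n).
Let Q n : \bar R := (\int[L]_(Y in G n) (pdens f Y)%:E)%E.
Let I n : \bar R := (\int[P]_w Ncrit [set x | x \in pts n w] k (r n))%E.
Let F : R := k.+1`!%:R.

Let B0 : 0 <= B. Proof. exact: le_trans B1. Qed.

Let F0 : 0 < F. Proof. by rewrite ltr0n fact_gt0. Qed.

Let mG n : measurable (G n). Proof. exact: measurable_good_tuples. Qed.
Let mC n : measurable (C n). Proof. exact: measurable_crowded. Qed.

Let Q_fin n : Q n \is a fin_num.
Proof.
rewrite ge0_fin_numE; last by apply: integral_ge0 => Y _; rewrite lee_fin pdens_ge0.
apply: (@le_lt_trans _ _ 1%E); last exact: ltry.
rewrite -(pdens_mass hlam hL mf f0 f1); apply: ge0_subset_integral => //.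
- by apply/measurable_EFinP; exact: measurable_pdens.
- by move=> Y _; rewrite lee_fin pdens_ge0.
Qed.

Let q n := fine (Q n).

Let q_ge0 n : 0 <= q n.
Proof. by apply/fine_ge0/integral_ge0 => Y _; rewrite lee_fin pdens_ge0. Qed.

Let m1G n : measurable_fun setT (fun w => (tupcount (pts n w) (G n))%:R%:E : \bar R).
Proof. by apply/measurable_EFinP; apply: measurable_tupcount. Qed.

Let m2C n : measurable_fun setT (fun w => (tupcount (pts n w) (C n))%:R%:E : \bar R).
Proof. by apply/measurable_EFinP; apply: measurable_tupcount. Qed.

Let expect_good n : (\int[P]_w (tupcount (pts n w) (G n))%:R%:E = (c1 n * q n)%:E)%E.
Proof.
rewrite (momentE (m1 n) hlam hL mf f0 f1 (c1_ge0 n) (e1 n))//.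
by rewrite EFinM /q fineK.
Qed.

Let expect_crowded n : (\int[P]_w (tupcount (pts n w) (C n))%:R%:E
  <= (c2 n * (B * (4 * r n) ^+ d * q n))%:E)%E.
Proof.
rewrite (momentE (m2 n) hlam hL2 mf f0 f1 (c2_ge0 n) (e2 n))//.
rewrite EFinM; apply: lee_wpmul2l; first by rewrite lee_fin.
rewrite EFinM /q fineK//.
exact: (crowded_le hlam hL hL2 mf f0 B0 fB (ltW (r0 n))).
Qed.

Let I_le n : (I n <= (F^-1 * (c1 n * q n))%:E)%E.
Proof.
rewrite EFinM -expect_good -ge0_integralZl_EFin ?invr_ge0 ?(ltW F0)//.
apply: le_lower_integral => w.
  by have [N [-> _ _]] := Ncrit_sandwich k (pts n w) (r n); rewrite lee_fin.
have [N [-> NG _]] := Ncrit_sandwich k (pts n w) (r n).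
by rewrite -EFinM lee_fin ler_pdivlMl// -natrM ler_nat.
Qed.

Let I_ge n : ((F^-1 * (c1 n * q n - c2 n * (B * (4 * r n) ^+ d * q n)))%:E <= I n)%E.
Proof.
pose T w := (tupcount (pts n w) (G n))%:R : R.
pose V w := (tupcount (pts n w) (C n))%:R : R.
have mT : measurable_fun setT T by exact: measurable_tupcount.
have mV : measurable_fun setT V by exact: measurable_tupcount.
(* The positive part keeps the minorant nonnegative, as monotonicity of lower integrals requires; it
   stays below [F * N] since that is nonnegative. *)
pose W w := Num.max 0 (T w - V w).
have mW : measurable_fun setT W.
  by apply: measurable_maxr => //; exact: measurable_funB.
have W0 w : 0 <= W w by rewrite le_max lexx.
apply: (@le_trans _ _ (\int[P]_w (F^-1%:E * (W w)%:E))%E); last first.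
  apply: le_lower_integral => w.
    by rewrite -EFinM lee_fin mulr_ge0// invr_ge0 ltW.
  have [N [-> _ TN]] := Ncrit_sandwich k (pts n w) (r n).
  rewrite -EFinM lee_fin ler_pdivrMl// ge_max; apply/andP; split.
    by rewrite mulr_ge0// ltW.
  by rewrite lerBlDr -natrM -natrD ler_nat.
rewrite ge0_integralZl_EFin ?invr_ge0 ?(ltW F0)//; last 2 first.
- by move=> w _; rewrite lee_fin.
- exact/measurable_EFinP.
rewrite EFinM; apply: lee_wpmul2l; first by rewrite lee_fin invr_ge0 ltW.
rewrite EFinB leeBlDr// -expect_good.
apply: (@le_trans _ _ (\int[P]_w (W w)%:E + \int[P]_w (V w)%:E)%E); last first.
  by apply: leeD2l; exact: expect_crowded.
rewrite -ge0_integralD//; last 4 first.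
- by move=> w _; rewrite lee_fin.
- exact/measurable_EFinP.
- by move=> w _; rewrite lee_fin.
- exact/measurable_EFinP.
apply: le_lower_integral => w; first by rewrite lee_fin.
rewrite -EFinD lee_fin -lerBlDr.
by rewrite le_max lexx orbT.
Qed.

(** A squeeze between [up - er] and [up]. The sample enters only through the moment factors: [c1]
    equivalent to [n ^+ k.+1] fixes the limit, [c2] at most [n ^+ k.+2] controls the error. *)
Lemma Ncrit_limit :
  (fun n => ((n%:R ^+ k.+1 * r n ^+ (d * k))^-1)%:E *
      \int[P]_w Ncrit [set x | x \in pts n w] k (r n))%E @ \oo -->
  ((k.+1`!%:R^-1)%:E * (\int[lam]_x (f x ^+ k.+1)%:E)
      * (\int[lamk]_Y (h1 (Y : 'M[R]_(k, d)))%:E))%E.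
Proof.
have := good_tuples_limit hlam hlamk hL mf f0 f1 B1 fB r0 rcvg.
set J := (\int[lam]_x (f x ^+ k.+1)%:E)%E; set H := (\int[lamk]_Y _)%E.
have J_fin : J \is a fin_num.
  rewrite ge0_fin_numE; last by apply: integral_ge0 => x _; rewrite lee_fin exprn_ge0.
  rewrite /J -(overlap0 lam f (0 : 'M[R]_(k, d))).
  by apply: (le_lt_trans (overlap_le _ _ _ _ _ _ _)) (ltry (B ^+ k)).
have mg : measurable (@good R k d 1 : set (E k)) := @measurable_good R k d 1.
have HE : H = lamk (@good R k d 1 : set (E k)).
  rewrite /H; under eq_integral do rewrite h1E.
  by rewrite integral_indic// setIT.
have H_fin : H \is a fin_num.
  rewrite HE ge0_fin_numE//; apply: le_lt_trans (lebesgue_cube 2 hlamk).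
  apply: le_measure; rewrite ?inE//; first exact: measurable_cube.
  by move=> Z gZ; apply/in_cube => i j; rewrite (le_trans (good_bound i j gZ))// mulr1.
rewrite -muleA -(fineK J_fin) -(fineK H_fin) -!EFinM.
set l := fine J * fine H => Qcvg.
have qcvg : (fun n => (r n ^+ (d * k))^-1 * q n) @ \oo --> l.
  have /fine_cvgP[_] := Qcvg; apply: cvg_trans; apply: near_eq_cvg.
  apply: nearW => n /=; rewrite (_ : integral _ _ _ = (q n)%:E)//.
  by rewrite /q fineK.
pose up n := F^-1 * ((c1 n / n%:R ^+ k.+1) * ((r n ^+ (d * k))^-1 * q n)).
(* Relative to the main term the intruder costs a factor [n] from its choice and
   [B * (4 * r n) ^+ d] from its location. *)
pose er n := F^-1 * ((n%:R * r n ^+ d) * (B * 4 ^+ d * ((r n ^+ (d * k))^-1 * q n))).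
have up_cvg : up @ \oo --> F^-1 * l.
  by apply: cvgMr; rewrite -[X in _ --> X]mul1r; apply: cvgM.
have lo_cvg : (fun n => up n - er n) @ \oo --> F^-1 * l.
  rewrite -[X in _ --> X]subr0; apply: cvgB => //.
  rewrite -[X in _ --> X](mulr0 F^-1); apply: cvgMr.
  rewrite -[X in _ --> X](mul0r (B * 4 ^+ d * l)); apply: cvgM => //.
  exact: cvgMr.
apply: (@squeeze_cvge _ _ _ _ (fun n => (up n - er n)%:E) _ (fun n => (up n)%:E)).
- near=> n.
  have n0 : 0 < n%:R :> R by rewrite ltr0n; near: n; exact: nbhs_infty_gt.
  have nk : n%:R ^+ k.+1 != 0 :> R by rewrite expf_neq0// gt_eqF.
  have rk : r n ^+ (d * k) != 0 by rewrite expf_neq0// gt_eqF.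
  have a0 : 0 <= (n%:R ^+ k.+1 * r n ^+ (d * k))^-1.
    by rewrite invr_ge0 mulr_ge0// exprn_ge0// ltW.
  apply/andP; split; last first.
    apply: (le_trans (lee_wpmul2l _ (I_le n))); first by rewrite lee_fin.
    rewrite -EFinM lee_fin /up le_eqVlt; apply/orP; left; apply/eqP.
    by field; rewrite nk rk gt_eqF.
  apply: (le_trans _ (lee_wpmul2l _ (I_ge n))); last by rewrite lee_fin.
  rewrite -EFinM lee_fin.
  have bound : c2 n * (B * (4 * r n) ^+ d * q n)
      <= n%:R ^+ k.+2 * (B * (4 * r n) ^+ d * q n).
    apply: ler_wpM2r; last exact: c2_le.
    rewrite !mulr_ge0// ?exprn_ge0// ?mulr_ge0 ?(ltW (r0 n))//.
  have -> : up n - er n = (n%:R ^+ k.+1 * r n ^+ (d * k))^-1 *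
      (F^-1 * (c1 n * q n - n%:R ^+ k.+2 * (B * (4 * r n) ^+ d * q n))).
    rewrite /up /er exprMn (exprS _ k.+1).
    move: nk rk; set a := _ ^+ k.+1; set b := _ ^+ (d * k).
    set e := r n ^+ d; set u := 4 ^+ d => nk rk.
    by field; rewrite nk rk gt_eqF.
  apply: ler_wpM2l => //; apply: ler_wpM2l; first by rewrite invr_ge0 ltW.
  by rewrite lerB.
- by apply: cvg_EFin; [exact: nearW|exact: lo_cvg].
- by apply: cvg_EFin; [exact: nearW|exact: up_cvg].
Unshelve. all: by end_near. Qed.

End CountLimit.

(** For [n >= m] the ratio is the finite product of the factors [1 - i / n]. *)
Lemma ffact_ratio_cvg (R : realType) m :
  (fun n => (n ^_ m)%:R / n%:R ^+ m : R) @ \oo --> (1 : R).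
Proof.
have invn : (fun n => n%:R^-1 : R) @ \oo --> (0 : R).
  by rewrite -cvg_shiftS; exact: cvg_harmonic.
have lim1 : (fun n => \prod_(i < m) (1 - i%:R * n%:R^-1)) @ \oo --> (1 : R).
  rewrite -[X in _ --> X](_ : \prod_(i < m) (1 : R) = 1); last by rewrite big1.
  apply: (@cvg_prodr R _ _ (fun (i : 'I_m) n => 1 - i%:R * n%:R^-1) (fun=> 1)) => i.
  rewrite -[X in _ --> X]subr0; apply: cvgB; first exact: cvg_cst.
  by rewrite -[X in _ --> X](mulr0 i%:R); apply: cvgMr.
apply: cvg_trans lim1; apply: near_eq_cvg; near=> n.
have n0 : n%:R != 0 :> R.
  by rewrite pnatr_eq0 -lt0n; near: n; exact: nbhs_infty_gt.
rewrite ffact_prod natr_prod -[X in _ ^+ X]card_ord -prodr_const -prodf_div.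
apply: eq_bigr => i _; rewrite natrB; first by rewrite mulrBl divff.
by rewrite ltnW// (leq_trans (ltn_ord i))//; near: n; exact: nbhs_infty_ge.
Unshelve. all: by end_near. Qed.

Lemma ffact_le_expn n m : (n ^_ m <= n ^ m)%N.
Proof.
rewrite ffact_prod -[X in (_ <= _ ^ X)%N]card_ord -prod_nat_const.
by apply: leq_prod => i _; exact: leq_subr.
Qed.

Theorem theorem3p1 (R : realType) (d k : nat)
  (hd : (1 <= d)%N) (hk1 : (1 <= k)%N) (hkd : (k <= d)%N)
  (* Lebesgue measure on R^d and on (R^d)^k *)
  (lam : {measure set (mxspace R 1 d) -> \bar R}) (hlam : is_lebesgue lam)
  (lamk : {measure set (mxspace R k d) -> \bar R}) (hlamk : is_lebesgue lamk)
  (* f : bounded probability density on R^d *)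
  (f : mxspace R 1 d -> R) (hfm : measurable_fun setT f)
  (hf0 : forall x, 0 <= f x) (hf1 : (\int[lam]_x (f x)%:E)%E = 1%E)
  (hfb : exists M : R, forall x, f x <= M)
  (* probability space *)
  (dO : measure_display) (Omega : measurableType dO) (P : probability Omega R)
  (* X_1, X_2, ... i.i.d. with density f  (indexed from 0 here) *)
  (X : nat -> Omega -> mxspace R 1 d) (hXm : forall i, measurable_fun setT (X i))
  (hXf : forall i (A : set (mxspace R 1 d)), measurable A ->
           P (X i @^-1` A) = (\int[lam]_(x in A) (f x)%:E)%E)
  (hXind : mutually_independent P X)
  (* P_n : Poisson point process with intensity n f *)
  (PP : nat -> Omega -> seq 'rV[R]_d)
  (hPP : forall n, is_poisson_process P lam (fun x => n%:R * f x) (PP n))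
  (* radii *)
  (r : nat -> R) (hr : forall n, 0 < r n) (hr0 : r @ \oo --> 0)
  (hnr : (fun n => n%:R * r n ^+ d) @ \oo --> 0) :
  let mu_k : \bar R :=
    (((k.+1)`!%:R^-1)%:E * (\int[lam]_x (f x ^+ k.+1)%:E)
      * (\int[lamk]_Y (h1 (Y : 'M[R]_(k, d)))%:E))%E in
  (fun n : nat => ((n%:R ^+ k.+1 * r n ^+ (d * k))^-1)%:E *
      \int[P]_w Ncrit [set x | exists2 i, (i < n)%N & x = X i w] k (r n))%E
    @ \oo --> mu_k
  /\
  (fun n : nat => ((n%:R ^+ k.+1 * r n ^+ (d * k))^-1)%:E *
      \int[P]_w Ncrit [set x | x \in PP n w] k (r n))%E
    @ \oo --> mu_k.
Proof.
move=> mu_k.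
have [M fM] := hfb.
(* The bound is raised to at least 1 so that its powers increase, as in the telescoping estimate. *)
pose B := Num.max 1 M.
have B1 : 1 <= B by rewrite le_max lexx.
have fB x : f x <= B by rewrite le_max fM orbT.
have [L hL] := exists_lebesgue hlam k.+1.
have [L2 hL2] := exists_lebesgue hlam k.+2.
split.
  have sampleE n w : [set x | exists2 i, (i < n)%N & x = X i w] = [set x | x \in sample X n w].
    apply/seteqP; split=> x /=.
      by move=> [i ? ->]; apply: map_f; rewrite mem_iota.
    by move=> /mapP[i]; rewrite mem_iota => ? ->; exists i.
  under eq_cvg do under eq_integral do rewrite sampleE.
  apply: (@Ncrit_limit R d k lam hlam lamk hlamk L hL L2 hL2 f hfm hf0 hf1 B B1 fB dO Omega P
    (sample X) (fun n => (n ^_ k.+1)%:R) (fun n => (n ^_ k.+2)%:R) r hr hr0 hnr).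
  - by move=> n; exact: ler0n.
  - exact: ffact_ratio_cvg.
  - by move=> n; exact: ler0n.
  - by move=> n; rewrite -natrX ler_nat ffact_le_expn.
  - by move=> n; exact: measurable_sample_counts.
  - by move=> n; exact: measurable_sample_counts.
  - by move=> n A mA; exact: (sample_moment hXm hXf hXind).
  - by move=> n A mA; exact: (sample_moment hXm hXf hXind).
apply: (@Ncrit_limit R d k lam hlam lamk hlamk L hL L2 hL2 f hfm hf0 hf1 B B1 fB dO Omega P
    PP (fun n => n%:R ^+ k.+1) (fun n => n%:R ^+ k.+2) r hr hr0 hnr).
- by move=> n; exact: exprn_ge0.
(* The ratio is 1 except at [n = 0], where inversion of 0 makes it 0. *)
- apply: cvg_near_cst; near=> n; rewrite divff// expf_neq0// pnatr_eq0 -lt0n.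
  by near: n; exact: nbhs_infty_gt.
- by move=> n; exact: exprn_ge0.
- by move=> n.
- by move=> n; exact: (measurable_poisson_counts (hPP n)).
- by move=> n; exact: (measurable_poisson_counts (hPP n)).
- by move=> n A mA; exact: (poisson_moment hfm hf0 hf1 (hPP n) mA).
- by move=> n A mA; exact: (poisson_moment hfm hf0 hf1 (hPP n) mA).
Unshelve. all: by end_near. Qed.
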